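(* Let $\alpha\in(1,2)$, let $\mathcal{L}\subset\mathcal{L}_0$ be a nonempty compact convex set of $\alpha$-stable L\'evy measures on $\mathbb{R}^d$, and let $\{Z_i\}_{i=1}^\infty$ be an i.i.d. sequence of $\mathbb{R}^d$-valued random variables on a sublinear expectation space $(\Omega,\mathcal{H},\hat{\mathbb{E}})$, with $S_n^3=\sum_{i=1}^nZ_i$. Assume: (A2) $\hat{\mathbb{E}}[Z_1]=\hat{\mathbb{E}}[-Z_1]=0$ and $M_z:=\sup_n\hat{\mathbb{E}}[n^{-1/\alpha}|S_n^3|]<\infty$; (A3) for each $\varphi\in C_b^3(\mathbb{R}^d)$ there is a function $l$ on $[0,1]$ with $l(s)\to0$ as $s\to0$ such that for all $z\in\mathbb{R}^d$ and $s\in(0,1]$, $$\frac1s\Big|\hat{\mathbb{E}}\big[\varphi(z+s^{1/\alpha}Z_1)-\varphi(z)\big]-s\sup_{F_\mu\in\mathcal{L}}\int_{\mathbb{R}^d}\delta_\lambda\varphi(z)F_\mu(d\lambda)\Big|\le l(s).$$ Then for every $\varphi\in C_b^3(\mathbb{R}^d)$ and $s\in[0,1]$, $$\lim_{n\to\infty}\Big|\hat{\mathbb{E}}\big[\varphi\big(z+(s/n)^{1/\alpha}S_n^3\big)-\varphi(z)\big]-s\sup_{F_\mu\in\mathcal{L}}\int_{\mathbb{R}^d}\delta_\lambda\varphi(z)F_\mu(d\lambda)\Big|=o(s)$$ uniformly in $z\in\mathbb{R}^d$, where $o(s)/s\to0$ as $s\to0$.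
   Context: **Sublinear expectations.** $\mathcal{H}$ is a linear space of real functions on a set $\Omega$ containing constants and closed under $X\mapsto|X|$. A sublinear expectation $\hat{\mathbb{E}}:\mathcal{H}\to\mathbb{R}$ is monotone, satisfies $\hat{\mathbb{E}}[c]=c$ for constants, is sub-additive, and satisfies $\hat{\mathbb{E}}[\lambda X]=\lambda\hat{\mathbb{E}}[X]$ for $\lambda>0$. $(\Omega,\mathcal{H},\hat{\mathbb{E}})$ is a sublinear expectation space. $C_{b,Lip}(\mathbb{R}^n)$ is the space of bounded Lipschitz functions. An $\mathbb{R}^n$-valued random variable $X$ is a map $\Omega\to\mathbb{R}^n$ with $\varphi(X)\in\mathcal{H}$ for all $\varphi\in C_{b,Lip}(\mathbb{R}^n)$; every random variable whose expectation is written is tacitly assumed to lie in $\mathcal{H}$; expectations of vectors are componentwise. $X\overset{d}{=}X'$ means $\hat{\mathbb{E}}[\varphi(X)]=\hat{\mathbb{E}}[\varphi(X')]$ for all $\varphi\in C_{b,Lip}$. $Y$ is independent from $X$ if $\hat{\mathbb{E}}[\varphi(X,Y)]=\hat{\mathbb{E}}[\hat{\mathbb{E}}[\varphi(x,Y)]_{x=X}]$ for all $\varphi\in C_{b,Lip}$ (not symmetric). A sequence $\{Z_i\}$ is i.i.d. if $Z_{i+1}\overset{d}{=}Z_i$ and $Z_{i+1}$ is independent from $(Z_1,\dots,Z_i)$ for every $i\ge1$. **L\'evy measures.** Fix $\alpha\in(1,2)$ and $0<\underline\Lambda<\overline\Lambda$. For a finite measure $\mu$ on the unit sphere $S=\{z\in\mathbb{R}^d:|z|=1\}$,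 $F_\mu(B)=\int_S\mu(dz)\int_0^\infty\mathbf{1}_B(rz)\frac{dr}{r^{1+\alpha}}$ for Borel $B\subset\mathbb{R}^d$. $\mathcal{L}_0=\{F_\mu:\mu(S)\in(\underline\Lambda,\overline\Lambda)\}$. Compactness of $\mathcal{L}$ is with respect to weak convergence of the measures $\mu$ on $S$. $C_b^3(\mathbb{R}^d)$: functions with bounded (continuous) derivatives of orders $0,1,2,3$. $\delta_\lambda\varphi(z)=\varphi(z+\lambda)-\varphi(z)-\langle D\varphi(z),\lambda\rangle$. *)

(* Defs.v *)
From HB Require Import structures.
From mathcomp Require Import all_boot all_order all_algebra.
From mathcomp Require Import all_classical all_reals all_analysis.
From mathcomp Require Import measurable_realfun.

Set Implicit Arguments.
Unset Strict Implicit.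
Unset Printing Implicit Defensive.

Import Order.TTheory GRing.Theory Num.Theory.
Import numFieldNormedType.Exports.

Local Open Scope classical_set_scope.
Local Open Scope ring_scope.

Section euclidean_space.
Context {R : realType} {d : nat}.
Local Notation E := 'rV[R]_d.

Definition dot (x y : E) : R := \sum_(i < d) x 0 i * y 0 i.

(* The library norm on row vectors is the sup norm. *)
Definition enorm (x : E) : R := Num.sqrt (dot x x).

Definition sphere : set E := [set z | enorm z = 1].

Definition grad (phi : E -> R) (z : E) : E :=
  \row_(i < d) 'D_(delta_mx 0 i : E) phi z.

Fixpoint Cb (k : nat) (phi : E -> R) : Prop :=
  [/\ bounded_fun (phi : E -> R^o), continuous phi &
      if k is k'.+1 then
        forall i : 'I_d,
          (forall x, derivable phi x (delta_mx 0 i : E)) /\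
          Cb k' (fun x => 'D_(delta_mx 0 i : E) phi x)
      else True].

Definition delta (lambda : E) (phi : E -> R) (z : E) : R :=
  phi (z + lambda) - phi z - dot (grad phi z) lambda.

End euclidean_space.
Arguments sphere : clear implicits.

Notation borel R d := (g_sigma_algebraType (@open 'rV[R]_d)).

Section borel_measurability.
Context {R : realType} {d : nat}.
Local Notation E := 'rV[R]_d.

Lemma open_borel (U : set E) : open U -> measurable (U : set (borel R d)).
Proof. by move=> oU; exact: sub_gen_smallest. Qed.

Lemma continuous_borel (f : E -> R) : continuous f ->
  measurable_fun [set: borel R d] (f : borel R d -> R).
Proof.
move=> /continuousP cf.
apply: (measurability _ (RGenOpens.measurableE R)).
move=> _ [_ [a [b ->]] <-]; rewrite setTI; apply: open_borel.
by apply: cf; exact: interval_open.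
Qed.

Lemma open_rV_rat (U : set E) : open U ->
  U = \bigcup_(p in [set p : 'rV[rat]_d * rat | 0 < p.2 /\
        forall y : E, (forall i, `|y 0 i - ratr (p.1 0 i)| < ratr p.2) -> U y])
      [set y : E | forall i, `|y 0 i - ratr (p.1 0 i)| < ratr p.2].
Proof.
move=> oU; apply/seteqP; split => [x Ux|x [p [_ pU]]]; last exact: pU.
have /nbhs_ballP[e /= e0 eU] : nbhs x U by exact: open_nbhs_nbhs.
have [q] := @rat_in_itvoo R 0 (e / 2) (divr_gt0 e0 (ltr0Sn R 1)).
rewrite in_itv/= => /andP[q0 qe].
have /choice[r rP] : forall i : 'I_d, exists t : rat,
    `|x 0 i - ratr t| < ratr q.
  move=> i; have [|t] := @rat_in_itvoo R (x 0 i - ratr q) (x 0 i + ratr q).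
    by rewrite ltrBlDr -addrA ltrDl addr_gt0.
  by rewrite in_itv/= => H; exists t; rewrite distrC ltr_distl.
exists (\row_i r i, q) => /=; last by move=> i; rewrite mxE.
split=> [|y yr]; first by rewrite -(@ltr0q R).
apply: eU; split => //= i j; rewrite ord1.
rewrite /ball/= [X in `|X|](_ : _ = (x 0 j - ratr (r j)) -
  (y 0 j - ratr (r j))); last by rewrite opprB addrA subrK.
rewrite (le_lt_trans (ler_normB _ _))// (splitr e) ltrD//.
  exact: lt_trans (rP j) qe.
by have := yr j; rewrite mxE => /lt_trans; exact.
Qed.

Lemma measurable_coord {d'} {T : measurableType d'} (f : T -> E) :
  (forall i, measurable_fun setT (fun t => f t 0 i)) ->
  measurable_fun setT (f : T -> borel R d).
Proof.
move=> mf; apply: (@measurability _ _ T (borel R d) setT f (@open E)) => //.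
move=> _ [U oU <-]; rewrite setTI (open_rV_rat oU) preimage_bigcup.
rewrite bigcup_mkcond; apply: countable_bigcupT_measurable.
  exact: countableP.
move=> p; case: ifPn => // _.
rewrite [X in measurable X](_ : _ =
    \bigcap_(i in [set: 'I_d]) ((fun t => `|f t 0 i - ratr (p.1 0 i)|) @^-1`
       `]-oo, ratr p.2[)); last first.
  apply/seteqP; split => t /=.
    by move=> H i _ /=; rewrite in_itv/=; exact: H.
  by move=> H i; have := H i I; rewrite /= in_itv.
apply: fin_bigcap_measurable => // i _; rewrite -[X in measurable X]setTI.
suff mfi : measurable_fun setT (fun t => `|f t 0 i - ratr (p.1 0 i)|).
  by apply: mfi => //; exact: measurable_itv.
by apply: measurableT_comp => //; exact: measurable_funB.
Qed.

Lemma measurable_scale :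
  measurable_fun setT
    (fun p : borel R d * R => (p.2 *: (p.1 : E)) : borel R d).
Proof.
apply: measurable_coord => i; under eq_fun do rewrite mxE.
apply: measurable_funM; first exact: measurable_snd.
have /continuous_borel mc : continuous (fun x : E => x 0 i).
  exact: coord_continuous.
exact: (measurableT_comp mc measurable_fst).
Qed.

Lemma continuous_enorm : continuous (@enorm R d).
Proof.
have cdot : continuous (fun x : E => dot x x).
  move=> x; apply: (@cvg_big _ _ +%R 0 xpredT (@add_continuous R^o) _ (nbhs x)).
  by move=> i _; apply: cvgM; exact: coord_continuous.
by move=> x; apply: continuous_comp; [exact: cdot|exact: sqrt_continuous].
Qed.

Lemma measurable_sphere : measurable (sphere R d : set (borel R d)).
Proof.
rewrite [X in measurable X](_ : _ = setT `&` @enorm R d @^-1` [set 1]).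
  by apply: (continuous_borel continuous_enorm) => //; exact: measurable_set1.
by rewrite setTI.
Qed.

End borel_measurability.

Section stable_levy_measures.
Context {R : realType} {d : nat}.
Local Notation E := 'rV[R]_d.
Local Notation lebesgue := (@lebesgue_measure R).

Definition radial (alpha : R) (B : set (borel R d)) (z : E) : \bar R :=
  (\int[lebesgue]_(r in `]0%R, +oo[)
     (\1_B (r *: z : borel R d) / r `^ (1 + alpha))%:E)%E.

(* A measure on the unit sphere is encoded as a Borel measure on the ambient
   space whose mass lies on the sphere, see [L0] below. *)
Definition F_ (alpha : R) (mu : {measure set (borel R d) -> \bar R})
    (B : set (borel R d)) : \bar R :=
  (\int[mu]_(z in sphere R d) radial alpha B z)%E.

Section F_measure.
Variables (alpha : R) (mu : {measure set (borel R d) -> \bar R}).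

Let radial_ge0 B z : (0 <= radial alpha B z)%E.
Proof.
by apply: integral_ge0 => r _; rewrite lee_fin divr_ge0// powR_ge0.
Qed.

Let mpow : measurable_fun [set: R] (fun r : R => (r `^ (1 + alpha))^-1).
Proof.
rewrite [X in measurable_fun _ X](_ : _ = fun r => r `^ (- (1 + alpha))).
  exact: measurable_powR.
by apply/funext => r; rewrite powRN.
Qed.

Let measurable_radial B : measurable B ->
  measurable_fun [set: borel R d] (radial alpha B : borel R d -> \bar R).
Proof.
move=> mB.
pose f (p : borel R d * R) := (\1_B (p.2 *: (p.1 : E) : borel R d) /
  p.2 `^ (1 + alpha) * \1_(`]0%R, +oo[ : set R) p.2)%:E.
have mf : measurable_fun setT f.
  apply/measurable_EFinP; apply: measurable_funM; first apply: measurable_funM.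
  - apply: (measurableT_comp _ measurable_scale); exact: measurable_indic.
  - exact: (measurableT_comp mpow measurable_snd).
  - by apply: (measurableT_comp _ measurable_snd); exact: measurable_indic.
have f0 p : (0 <= f p)%E.
  by rewrite lee_fin mulr_ge0// divr_ge0// powR_ge0.
have := @measurable_fun_fubini_tonelli_F _ _ _ _ R lebesgue f mf f0.
congr (measurable_fun _ _); apply/funext => z.
rewrite /fubini_F /radial [RHS]integral_mkcond; apply: eq_integral => r _.
rewrite patchE /f/=; have [rp|rn] := boolP (r \in _).
  by rewrite [\1__ r]indicE rp mulr1.
by rewrite [\1__ r]indicE (negbTE rn) mulr0.
Qed.

Let F0 : F_ alpha mu set0 = 0%E.
Proof.
rewrite /F_ integral0_eq// => z _; rewrite /radial integral0_eq// => r _.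
by rewrite indic0 mul0r.
Qed.

Let F_ge0 B : (0 <= F_ alpha mu B)%E.
Proof. by apply: integral_ge0 => z _; exact: radial_ge0. Qed.

Let F_sigma_additive : semi_sigma_additive (F_ alpha mu).
Proof.
move=> B mB tB mUB.
rewrite [X in _ --> X](_ : _ = (\sum_(n <oo) F_ alpha mu (B n))%E).
  by apply: is_cvg_nneseries => n _ _; exact: F_ge0.
rewrite -integral_nneseries//; last 2 first.
- exact: measurable_sphere.
- by move=> n; apply: measurable_funTS; exact: measurable_radial.
apply: eq_integral => z _; rewrite /radial -integral_nneseries//.
- apply: eq_integral => r _.
  under eq_eseriesr do rewrite mulrC EFinM.
  by rewrite nneseriesZl// mulrC EFinM indic_bigcup.
- move=> n; apply: measurable_funTS; apply/measurable_EFinP.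
  apply: measurable_funM => //.
  pose g (r : R) : borel R d * R := (z, r).
  have mg : measurable_fun setT g by exact: measurable_fun_pair.
  apply: (measurableT_comp _ (measurableT_comp measurable_scale mg)).
  exact: measurable_indic.
- by move=> n r _; rewrite lee_fin divr_ge0// powR_ge0.
Qed.

HB.instance Definition _ := isMeasure.Build _ _ _ (F_ alpha mu)
  F0 F_ge0 F_sigma_additive.

End F_measure.

Definition spherical : set {finite_measure set (borel R d) -> \bar R} :=
  [set mu | mu (~` sphere R d) = 0%E].

Definition L0 (alpha lo hi : R) : set {measure set (borel R d) -> \bar R} :=
  [set (F_ alpha mu : {measure set (borel R d) -> \bar R}) |
     mu in [set mu | spherical mu /\
                     (lo%:E < mu (sphere R d) < hi%:E)%E]].

(* Measures are only constrained on Borel sets, hence the comparison of the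
   combination with a member of [L] on Borel sets only. *)
Definition convex_measures (L : set {measure set (borel R d) -> \bar R}) :=
  forall nu1 nu2 (t : R), L nu1 -> L nu2 -> 0 <= t <= 1 ->
  exists2 nu, L nu & forall B, measurable B ->
    nu B = (t%:E * nu1 B + (1 - t)%:E * nu2 B)%E.

Definition finite_measures := {finite_measure set (borel R d) -> \bar R}.
HB.instance Definition _ := gen_eqMixin finite_measures.
HB.instance Definition _ := gen_choiceMixin finite_measures.

Definition sphere_fun := {f : E -> R | {within sphere R d, continuous f}}.
HB.instance Definition _ := gen_eqMixin sphere_fun.
HB.instance Definition _ := gen_choiceMixin sphere_fun.

Definition weak_eval (mu : finite_measures) : {ptws sphere_fun -> R} :=
  fun f => \int[mu]_(z in sphere R d) (sval f z).

(* Topology of weak convergence: the coarsest one for which integration of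
   every continuous function on the sphere is continuous. *)
Definition weak_measures := initial_topology weak_eval.

Definition compact_levy (alpha : R)
    (L : set {measure set (borel R d) -> \bar R}) :=
  compact ([set mu | spherical mu /\ L (F_ alpha mu)] : set weak_measures).

Definition levy_sup (L : set {measure set (borel R d) -> \bar R})
    (phi : E -> R) (z : E) : R :=
  sup [set \int[nu]_lambda delta lambda phi z | nu in L].

End stable_levy_measures.

Definition Cblip {R : realType} {V : normedModType R} (phi : V -> R) :=
  bounded_fun (phi : V -> R^o) /\ exists k : R, k.-lipschitz (phi : V -> R^o).

(* [Ehat] is only meaningful on [dom]; its values elsewhere are unconstrained. *)
Record sublinear_space (R : realType) (Omega : Type) := SublinearSpace {
  dom : set (Omega -> R) ;
  Ehat : (Omega -> R) -> R ;
  dom_cst : forall c, dom (fun=> c) ;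
  dom_add : forall X Y, dom X -> dom Y -> dom (fun w => X w + Y w) ;
  dom_scale : forall c X, dom X -> dom (fun w => c * X w) ;
  dom_abs : forall X, dom X -> dom (fun w => `|X w|) ;
  Ehat_mono : forall X Y, dom X -> dom Y -> (forall w, X w <= Y w) ->
    Ehat X <= Ehat Y ;
  Ehat_cst : forall c, Ehat (fun=> c) = c ;
  Ehat_subadd : forall X Y, dom X -> dom Y ->
    Ehat (fun w => X w + Y w) <= Ehat X + Ehat Y ;
  Ehat_scale : forall c X, dom X -> 0 < c -> Ehat (fun w => c * X w) = c * Ehat X
}.

Section random_variables.
Context {R : realType} {Omega : Type} (S : sublinear_space R Omega).

Definition random_var (V : normedModType R) (X : Omega -> V) :=
  forall phi : V -> R, Cblip phi -> dom S (phi \o X).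

Definition same_law (V : normedModType R) (X Y : Omega -> V) :=
  forall phi : V -> R, Cblip phi -> Ehat S (phi \o X) = Ehat S (phi \o Y).

(* [independent Y X]: [Y] is independent from [X]; not symmetric. *)
Definition independent (V W : normedModType R) (Y : Omega -> W)
    (X : Omega -> V) :=
  random_var (fun w => (X w, Y w)) /\
  forall phi : V * W -> R, Cblip phi ->
    Ehat S (fun w => phi (X w, Y w)) =
    Ehat S (fun w => Ehat S (fun w' => phi (X w, Y w'))).

Definition tupleR (d : nat) (Z : nat -> Omega -> 'rV[R]_d) (i : nat)
    (w : Omega) : 'M[R]_(i.+1, d) := \matrix_(k < i.+1) Z k w.

(* Indices start at 0: [Z i] is the (i+1)-st term of the sequence. *)
Definition iid (d : nat) (Z : nat -> Omega -> 'rV[R]_d) :=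
  forall i, same_law (Z i.+1) (Z i) /\ independent (Z i.+1) (tupleR Z i).

Definition Evec (d : nat) (X : Omega -> 'rV[R]_d) : 'rV[R]_d :=
  \row_(j < d) Ehat S (fun w => X w 0 j).

Definition psum (d : nat) (Z : nat -> Omega -> 'rV[R]_d) (n : nat)
    (w : Omega) : 'rV[R]_d := \sum_(i < n) Z i w.

End random_variables.

(* Main.v *)
(* Writing T_h u (z) = E[u (z + h^(1/alpha) Z_1)], independence turns
   E[u (z + (s/n)^(1/alpha) S_n)] into the n-th iterate of T_(s/n), and T_h is
   a monotone, sublinear, translation invariant contraction.  Every smoothing P
   by averages of translates therefore satisfies T (P u) <= P (T u): the
   smoothed iterates of one scheme are supersolutions for any other scheme
   which is close to it on smooth functions.  Applied to T_h and to the m-th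
   iterate of T_(h/m), in both directions, this makes the iterates a Cauchy
   sequence, uniformly in z.

   The closeness must be uniform over all smoothings of functions with given
   bound and Lipschitz constant, while the rate in (A3) depends on the test
   function.  If it failed, violating functions could be placed around far
   apart centres inside a single test function, contradicting (A3), which is
   uniform in z; the error made by gluing is controlled by a tail estimate
   that follows from (A3) for one bump function and the scaling of T_h.

   The o(s) bound on the limit comes from summing T^(k+1) phi - T^k phi, which
   is h T^k (D phi) up to sublinearity, D phi being a difference quotient at a
   fixed scale, Lipschitz, hence almost unchanged by T^k thanks to (A2). *)
Require Import Defs.
From HB Require Import structures.
From mathcomp Require Import all_boot all_order all_algebra.
From mathcomp Require Import all_classical all_reals all_analysis.
From mathcomp Require Import ring lra.

Set Implicit Arguments.
Unset Strict Implicit.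
Unset Printing Implicit Defensive.

Import Order.TTheory GRing.Theory Num.Theory.
Import numFieldNormedType.Exports.

Local Open Scope classical_set_scope.
Local Open Scope ring_scope.

(** * Means over an interval and their Riemann sums *)

Section mean_value.
Context {R : realType}.
Implicit Types (g F : R -> R) (e h L : R).

Lemma lipschitz_fun_continuous (V : normedModType R) (f : V -> R) (L : R) :
  (forall x y, `|f x - f y| <= L * `|x - y|) -> continuous f.
Proof.
move=> fL x; apply/cvgrPdist_le => /= e e0; near=> y.
apply: (le_trans (fL _ _)).
have M0 : 0 < `|L| + 1 by rewrite ltr_wpDl.
have : `|x - y| <= e / (`|L| + 1).
  by near: y; apply: cvgr_dist_le => //; rewrite divr_gt0.
rewrite ler_pdivlMr// => xy.
apply: le_trans xy; rewrite mulrC ler_wpM2l//.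
by rewrite (le_trans (ler_norm _))// lerDl.
Unshelve. all: by end_near. Qed.

(** The integral from the left end is differentiable only strictly inside the interval, so callers
    enlarge the range on both sides. *)
Lemma antiderivative_exists g (a b : R) : continuous g ->
  exists F, forall t, a < t < b -> is_derive t 1 F (g t).
Proof.
move=> cg.
exists (fun x => \int[lebesgue_measure]_(t in `[a, x]) g t) => t /andP[at_ tb].
have [] := @continuous_FTC1_closed R g a t b tb _ at_ (cg t).
  apply: continuous_compact_integrable; first exact: segment_compact.
  exact: continuous_subspaceT.
move=> dF <-; rewrite derive1E; exact/derivableP.
Qed.

Definition mean e g : R :=
  e^-1 * \int[lebesgue_measure]_(t in `[0, e]) g t.

(** One [F] serves all translations [h], so differentiating the mean in [h] reduces to
    differentiating [F]. *)
Lemma mean_antiderivative e h a b g F : 0 < e -> a < h -> h + e < b ->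
  continuous g -> (forall t, a < t < b -> is_derive t 1 F (g t)) ->
  mean e (fun t => g (t + h)) = e^-1 * (F (h + e) - F h).
Proof.
move=> e0 ah hb cg dF; rewrite /mean; congr (_ * _).
pose G := F \o (fun t => t + h).
have dG t : a < t + h < b -> is_derive t 1 G (g (t + h)).
  move=> /dF dFt.
  have := @is_derive1_comp R F (fun t => t + h) t (g (t + h)) 1 dFt _.
  rewrite mulr1; apply; apply: is_derive_eq; by rewrite addr0.
have cG t : a < t + h < b -> {for t, continuous G}.
  by move=> /dG [dGt _]; apply: differentiable_continuous; apply/derivable1_diffP.
rewrite /Rintegral (@continuous_FTC2 R (fun t => g (t + h)) G 0 e e0).
- by rewrite /= /G/= add0r (addrC e).
- apply: continuous_subspaceT => t; apply: continuous_comp; last exact: cg.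
  by apply: cvgD; [exact: cvg_id|exact: cvg_cst].
- split => [t| |].
  + rewrite in_itv/= => /andP[t0 te]; apply: (@ex_derive _ _ _ _ _ _ _ (dG t _)).
    by apply/andP; split; lra.
  + by apply: cvg_at_right_filter; apply: cG; lra.
  + by apply: cvg_at_left_filter; apply: cG; lra.
- move=> t; rewrite in_itv/= => /andP[t0 te].
  rewrite derive1E; apply: (@derive_val _ _ _ _ _ _ _ (dG t _)).
  by apply/andP; split; lra.
Qed.

Definition riemann e N g : R :=
  N.+1%:R^-1 * \sum_(k < N.+1) g (k%:R * (e / N.+1%:R)).

(** On each cell the mean value theorem writes the increment of [F] as [g c] times the cell length,
    with [c] within one cell length of the left end. Riemann sums matter because subadditivity of an
    operator handles finite sums. *)
Lemma mean_riemann e N L g : 0 < e ->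
  (forall x y, `|g x - g y| <= L * `|x - y|) ->
  `|mean e g - riemann e N g| <= L * (e / N.+1%:R).
Proof.
move=> e0 gL; have cg := @lipschitz_fun_continuous R^o g L gL.
have [F dF] := @antiderivative_exists g (-1) (e + 1) cg.
have -> : mean e g = e^-1 * (F (0 + e) - F 0).
  rewrite -(@mean_antiderivative e 0 (-1) (e + 1) g F e0)//; try lra.
  by congr mean; apply/funext => t; rewrite addr0.
set n := N.+1%:R; have n0 : 0 < n by rewrite ltr0n.
set r := e / n; have r0 : 0 < r by rewrite divr_gt0.
have -> : F (0 + e) - F 0 = \sum_(0 <= k < N.+1) (F (k.+1%:R * r) - F (k%:R * r)).
  rewrite telescope_sumr// mul0r add0r; congr (F _ - _).
  by rewrite /r mulrC divfK// gt_eqF.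
rewrite big_mkord /riemann -/n -/r.
have -> : e^-1 = n^-1 * r^-1.
  by rewrite /r invf_div mulrA mulVf ?mul1r// gt_eqF.
rewrite -mulrA -mulrBr mulr_sumr -sumrB normrM gtr0_norm ?invr_gt0//.
rewrite ler_pdivrMl//.
apply: le_trans (ler_norm_sum _ _ _) _.
apply: (@le_trans _ _ (\sum_(k < N.+1) L * r)); last first.
  by rewrite sumr_const card_ord -[_ *+ N.+1]mulr_natl.
apply: ler_sum => k _.
have kr : k%:R * r <= k.+1%:R * r by rewrite ler_pM2r// ler_nat.
have kr0 : 0 <= k%:R * r by rewrite mulr_ge0// ltW.
have kre : k.+1%:R * r <= e.
  have -> : e = n * r by rewrite /r mulrC divfK// gt_eqF.
  by rewrite ler_pM2r// ler_nat.
have dF' x : k%:R * r <= x <= k.+1%:R * r -> is_derive x 1 F (g x).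
  by move=> /andP[? ?]; apply: dF; lra.
have [||c cI ->] := @MVT_segment R F g _ _ kr.
- by move=> x; rewrite in_itv/= => /andP[/ltW ? /ltW ?]; apply: dF'; apply/andP.
- apply: continuous_in_subspaceT => x; rewrite inE/= in_itv/= => /dF'[dFx _].
  by apply: differentiable_continuous; apply/derivable1_diffP.
have -> : k.+1%:R * r - k%:R * r = r by rewrite -mulrBl -natrB// subSnn mul1r.
rewrite mulrC mulfK ?gt_eqF//.
apply: le_trans (gL _ _) _.
have L0 : 0 <= L by have := gL 1 0; rewrite subr0 normr1 mulr1; apply: le_trans.
apply: ler_wpM2l => //.
move: cI; rewrite in_itv/= => /andP[c1 c2].
rewrite ger0_norm ?subr_ge0// lerBlDr (le_trans c2)//.
by rewrite -natr1 mulrDl mul1r addrC.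
Qed.

Lemma le_of_natP (a b C : R) : (forall N : nat, a <= b + C / N.+1%:R) -> a <= b.
Proof.
move=> ab; apply/ler_addgt0Pr => e e0; apply: (le_trans (ab (Num.bound (`|C| / e)))).
rewrite lerD2l ler_pdivrMr ?ltr0n// mulrC.
have := @archi_boundP R (`|C| / e) (divr_ge0 (normr_ge0 _) (ltW e0)).
rewrite ltr_pdivrMr// => CN; rewrite (le_trans (ler_norm _))// (le_trans (ltW CN))//.
by rewrite ler_pM2r// ler_nat.
Qed.

End mean_value.

(** * Bounded Lipschitz functions with explicit constants *)

Section bounded_lipschitz.
Context {R : realType} {V : normedModType R}.
Implicit Types (u v : V -> R) (B L c : R).

(** Both constants are preserved by the schemes, and uniformity is always over functions with given
    [B] and [L]. *)
Definition BL B L u :=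
  (forall x, `|u x| <= B) /\ (forall x y, `|u x - u y| <= L * `|x - y|).

Definition bl u := exists B L, BL B L u.

Lemma BL_bl B L u : BL B L u -> bl u. Proof. by exists B, L. Qed.

Lemma bl_cst c : bl (fun=> c).
Proof.
by exists `|c|, 0; split=> [//|x y]; rewrite subrr normr0 mul0r.
Qed.

Lemma BL_scale B L c u : BL B L u -> BL (`|c| * B) (`|c| * L) (fun x => c * u x).
Proof.
move=> [uB uL]; split=> [x|x y]; first by rewrite normrM ler_wpM2l.
by rewrite -mulrBr normrM -mulrA ler_wpM2l.
Qed.

Lemma BL_add B L B' L' u v : BL B L u -> BL B' L' v ->
  BL (B + B') (L + L') (fun x => u x + v x).
Proof.
move=> [uB uL] [vB vL]; split=> [x|x y].
  by rewrite (le_trans (ler_normD _ _))// lerD.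
rewrite opprD addrACA mulrDl (le_trans (ler_normD _ _))// lerD//.
Qed.

Lemma bl_add u v : bl u -> bl v -> bl (fun x => u x + v x).
Proof. by move=> [B [L uBL]] [B' [L' vBL]]; apply: BL_bl (BL_add uBL vBL). Qed.

Lemma bl_scale c u : bl u -> bl (fun x => c * u x).
Proof. by move=> [B [L uBL]]; apply: BL_bl (BL_scale c uBL). Qed.

Lemma bl_sub u v : bl u -> bl v -> bl (fun x => u x - v x).
Proof.
move=> blu /(bl_scale (-1)) /(bl_add blu).
by under eq_fun do rewrite mulN1r.
Qed.

Lemma BL_shift B L u a : BL B L u -> BL B L (fun x => u (x + a)).
Proof.
move=> [uB uL]; split=> [//|x y]; apply: (le_trans (uL _ _)).
by rewrite opprD addrACA subrr addr0.
Qed.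

Lemma bl_shift u a : bl u -> bl (fun x => u (x + a)).
Proof. by move=> [B [L uBL]]; apply: BL_bl (BL_shift a uBL). Qed.

Lemma BL_ge0 B L u : BL B L u -> 0 <= B.
Proof. by move=> [uB _]; exact: le_trans (uB 0). Qed.

Lemma BL_continuous B L u : BL B L u -> continuous u.
Proof. by move=> [_ uL]; exact: lipschitz_fun_continuous uL. Qed.

Lemma BL_Cblip B L u : BL B L u -> Cblip u.
Proof.
move=> [uB uL]; split.
  by exists B; split; [exact: num_real|move=> M /ltW BM x _; exact: le_trans BM].
by exists L => -[x y] _ /=; exact: uL.
Qed.

Lemma bl_sum n (a : 'I_n -> V) u : bl u -> bl (fun y => \sum_(k < n) u (y + a k)).
Proof.
move=> blu; elim: n a => [|n IH] a.
  by under eq_fun do rewrite big_ord0; exact: bl_cst.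
under eq_fun do rewrite big_ord_recl.
by apply: bl_add; [exact: bl_shift|exact: (IH (fun k => a (lift ord0 k)))].
Qed.

Lemma bl_nonneg u : bl u -> exists B L, 0 <= L /\ BL B L u.
Proof.
move=> [B [L [uB uL]]]; exists B, `|L|; split=> //; split=> // x y.
by apply: (le_trans (uL x y)); apply: ler_wpM2r => //; exact: ler_norm.
Qed.

End bounded_lipschitz.

(** * Monotone, sublinear, translation invariant operators *)

Section sublinear_operator.
Context {R : realType} {V : normedModType R}.
Implicit Types (u v : V -> R) (B L c : R) (T : (V -> R) -> V -> R).

Record sublinear_op T : Prop := SublinearOp {
  op_mono : forall u v, bl u -> bl v -> (forall x, u x <= v x) ->
    forall x, T u x <= T v x ;
  op_add : forall u v, bl u -> bl v ->
    forall x, T (fun y => u y + v y) x <= T u x + T v x ;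
  op_scale : forall c u, 0 < c -> bl u ->
    forall x, T (fun y => c * u y) x = c * T u x ;
  op_shift : forall a u x, T (fun y => u (y + a)) x = T u (x + a) ;
  op_cst : forall c x, T (fun=> c) x = c }.

Variable T : (V -> R) -> V -> R.
Hypothesis sT : sublinear_op T.

Lemma op_le_addr u v c : bl u -> bl v -> (forall x, u x <= v x + c) ->
  forall x, T u x <= T v x + c.
Proof.
move=> blu blv uv x; apply: le_trans (op_mono sT blu (bl_add blv (bl_cst c)) uv x) _.
by apply: le_trans (op_add sT blv (bl_cst c) x) _; rewrite op_cst.
Qed.

Lemma op_dist u v c : bl u -> bl v -> (forall x, `|u x - v x| <= c) ->
  forall x, `|T u x - T v x| <= c.
Proof.
move=> blu blv uv x.
have uv' y : - c <= u y - v y <= c by rewrite -ler_norml.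
have := op_le_addr blu blv (c := c) _ x; have := op_le_addr blv blu (c := c) _ x.
move=> /(_ _) vu /(_ _) uv2.
rewrite ler_norml; apply/andP; split.
  suff : T v x <= T u x + c by lra.
  by apply: vu => y; have /andP[] := uv' y; lra.
suff : T u x <= T v x + c by lra.
by apply: uv2 => y; have /andP[] := uv' y; lra.
Qed.

(** For the Lipschitz bound, translation invariance turns [T u x] into the value at [y] of [T] on a
    translate of [u], which lies at sup distance at most [L * |x - y|] from [u]; [op_dist] then
    applies. *)
Lemma op_BL B L u : BL B L u -> BL B L (T u).
Proof.
move=> uBL; have blu := BL_bl uBL; have [uB uL] := uBL; split=> [x|x y].
  have := @op_dist u (fun=> 0) B blu (bl_cst 0) _ x.
  by rewrite op_cst// subr0; apply => z; rewrite subr0.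
have -> : T u x = T (fun z => u (z + (x - y))) y.
  by rewrite op_shift// addrC subrK.
apply: op_dist => //; first exact: bl_shift.
by move=> z; apply: (le_trans (uL _ _)); rewrite addrAC subrr add0r.
Qed.

Lemma op_bl u : bl u -> bl (T u).
Proof. by move=> [B [L /op_BL uBL]]; exact: BL_bl uBL. Qed.

Lemma op_sub u v : bl u -> bl v -> forall x, T u x - T v x <= T (fun y => u y - v y) x.
Proof.
move=> blu blv x; rewrite lerBlDr; have := op_add sT (bl_sub blu blv) blv x.
by congr (T _ x <= _); apply/funext => y; rewrite subrK.
Qed.

Lemma op_addc u c : bl u -> forall x, T (fun y => u y + c) x = T u x + c.
Proof.
move=> blu x; apply/eqP; rewrite eq_le; apply/andP; split.
  by apply: op_le_addr => //; exact: bl_add (bl_cst c).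
rewrite -lerBrDr; apply: op_le_addr => //; first exact: bl_add (bl_cst c).
by move=> y; rewrite addrK.
Qed.

Lemma op_scale0 c u : 0 <= c -> bl u -> forall x, T (fun y => c * u y) x = c * T u x.
Proof.
rewrite le_eqVlt => /predU1P[<-|c0] blu x; last exact: op_scale.
by rewrite mul0r; under [X in T X]eq_fun do rewrite mul0r; rewrite op_cst.
Qed.

(** Jensen's inequality for sums of translates, the discrete form of [op_stek]: subadditivity splits
    the sum and translation invariance takes each shift outside. *)
Lemma op_sum n c (a : 'I_n -> V) u : 0 <= c -> bl u -> forall x,
  T (fun y => c * \sum_(k < n) u (y + a k)) x <= c * \sum_(k < n) T u (x + a k).
Proof.
move=> c0 blu x.
rewrite (op_scale0 c0 (bl_sum a blu)) ler_wpM2l//.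
elim: n a => [|n IH] a.
  by under [X in T X]eq_fun do rewrite big_ord0; rewrite big_ord0 op_cst.
under [X in T X]eq_fun do rewrite big_ord_recl.
rewrite big_ord_recl.
have := op_add sT (bl_shift (a ord0) blu) (bl_sum (fun k => a (lift ord0 k)) blu) x.
move=> /le_trans; apply; rewrite op_shift// lerD2l.
exact: (IH (fun k => a (lift ord0 k))).
Qed.

End sublinear_operator.

Lemma sublinear_op_comp {R : realType} {V : normedModType R}
    (T1 T2 : (V -> R) -> V -> R) :
  sublinear_op T1 -> sublinear_op T2 -> sublinear_op (fun u => T1 (T2 u)).
Proof.
move=> s1 s2; split.
- move=> u v blu blv uv; apply: (op_mono s1); try exact: op_bl.
  exact: op_mono.
- move=> u v blu blv x.
  apply: le_trans (op_add s1 (op_bl s2 blu) (op_bl s2 blv) x).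
  apply: (op_mono s1); last exact: op_add.
    by apply: op_bl => //; exact: bl_add.
  by apply: bl_add; exact: op_bl.
- move=> c u c0 blu x; rewrite -(op_scale s1 c0 (op_bl s2 blu)).
  by congr (T1 _ x); apply/funext => y; exact: op_scale.
- move=> a u x; rewrite -op_shift//.
  by congr (T1 _ x); apply/funext => y; exact: op_shift.
- move=> c x; rewrite (_ : T2 _ = (fun=> c)) ?op_cst//.
  by apply/funext => y; exact: op_cst.
Qed.

Lemma sublinear_op_id {R : realType} {V : normedModType R} :
  sublinear_op (fun u : V -> R => u).
Proof. by split. Qed.

Lemma sublinear_op_iter {R : realType} {V : normedModType R}
    (T : (V -> R) -> V -> R) n : sublinear_op T -> sublinear_op (iter n T).
Proof.
move=> sT; elim: n => [|n IH]; first exact: sublinear_op_id.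
exact: sublinear_op_comp IH.
Qed.

(** * Averages along one coordinate direction *)

Section steklov.
Context {R : realType} {d : nat}.
Local Notation E := 'rV[R]_d.
Implicit Types (u v : E -> R) (i j : 'I_d) (e B L c : R).

(* Steklov average in the direction of the [i]-th coordinate. *)
Definition stek e i u (z : E) : R := mean e (fun t => u (z + t *: delta_mx 0 i)).

Lemma row_norm_le (x : E) c : 0 <= c -> (forall i, `|x 0 i| <= c) -> `|x| <= c.
Proof.
move=> c0 xc; rewrite /Num.norm/= mx_normrE; apply/bigmax_leP; split => //= -[a b] _ /=.
by rewrite ord1.
Qed.

Lemma row_norm_ge (x : E) i : `|x 0 i| <= `|x|.
Proof.
by rewrite [leRHS]/Num.norm/= mx_normrE; apply/bigmax_geP; right; exists (0, i).
Qed.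

Lemma norm_delta i : `|delta_mx 0 i : E| = 1.
Proof.
apply/eqP; rewrite eq_le; apply/andP; split.
  apply: row_norm_le => // j; rewrite mxE eqxx /=.
  by case: eqP => _; rewrite ?normr1 ?normr0.
by have := row_norm_ge (delta_mx 0 i) i; rewrite mxE !eqxx normr1.
Qed.

Lemma BL_line B L u z i : BL B L u ->
  BL B L (fun t : R => u (z + t *: delta_mx 0 i)).
Proof.
move=> [uB uL]; split=> [//|x y]; apply: (le_trans (uL _ _)).
rewrite (_ : z + _ - _ = (x - y) *: delta_mx 0 i); last first.
  by rewrite scalerBl opprD addrACA subrr add0r.
by rewrite normrZ norm_delta mulr1.
Qed.

Lemma bl_line_integrable u z i a b : bl u ->
  lebesgue_measure.-integrable `[a, b] (EFin \o (fun t : R => u (z + t *: delta_mx 0 i))).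
Proof.
move=> [B [L uBL]]; apply: continuous_compact_integrable.
  exact: segment_compact.
apply: continuous_subspaceT; exact: BL_continuous (BL_line z i uBL).
Qed.

Lemma stek_scale e i c u z : bl u -> stek e i (fun x => c * u x) z = c * stek e i u z.
Proof.
move=> blu; rewrite /stek /mean.
rewrite mulrCA; congr (_ * _).
by apply: (@RintegralZl _ _ R lebesgue_measure) => //; exact: bl_line_integrable.
Qed.

Lemma stek_sublinear e i : 0 < e -> sublinear_op (stek e i).
Proof.
move=> e0; split.
- move=> u v blu blv uv x; rewrite /stek /mean; apply: ler_wpM2l; first by rewrite invr_ge0 ltW.
  by apply: (@le_Rintegral _ _ R lebesgue_measure) => //; exact: bl_line_integrable.
- move=> u v blu blv x; rewrite /stek /mean -mulrDr le_eqVlt; apply/orP; left; apply/eqP; congr (_ * _).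
  by apply: (@RintegralD _ _ R lebesgue_measure) => //; exact: bl_line_integrable.
- by move=> c u _ blu x; exact: stek_scale.
- by move=> a u x; rewrite /stek; congr mean; apply/funext => t; rewrite addrAC.
- move=> c x; rewrite /stek /mean (@Rintegral_cst _ _ R lebesgue_measure)//=.
  rewrite lebesgue_measure_itv/= lte_fin e0.
  by rewrite oppr0 addr0/= mulrCA mulVf ?mulr1// gt_eqF.
Qed.

Lemma stek_sub e i u v z : 0 < e -> bl u -> bl v ->
  stek e i (fun x => u x - v x) z = stek e i u z - stek e i v z.
Proof.
move=> e0 blu blv; have sA := stek_sublinear i e0.
apply/eqP; rewrite eq_le op_sub// andbT.
under [X in stek _ _ X]eq_fun do rewrite -mulN1r.
apply: le_trans (op_add sA blu (bl_scale (-1) blv) z) _.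
by rewrite stek_scale// mulN1r.
Qed.

Lemma stek_close e i B L u z : 0 < e -> BL B L u -> `|stek e i u z - u z| <= L * e.
Proof.
move=> e0 uBL; have [_ gL] := BL_line z i uBL.
have := mean_riemann 0 e0 gL; rewrite /riemann big_ord1 invr1 mul1r mul0r.
by rewrite scale0r addr0 mulr1.
Qed.

(** Riemann sums approximate the average with error [L * (e / N.+1%:R)], both for [u] and for [T u],
    which has the same constant [L]; hence [op_sum] passes to the limit in [N]. *)
Lemma op_stek T e i u z : sublinear_op T -> 0 < e -> bl u ->
  T (stek e i u) z <= stek e i (T u) z.
Proof.
move=> sT e0 [B [L uBL]]; have blu := BL_bl uBL; have sA := stek_sublinear i e0.
apply: (@le_of_natP _ _ _ (2 * L * e)) => N.
pose a (k : 'I_N.+1) : E := (k%:R * (e / N.+1%:R)) *: delta_mx 0 i.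
pose r w x : R := N.+1%:R^-1 * \sum_(k < N.+1) w (x + a k).
have rP w x : BL B L w -> `|stek e i w x - r w x| <= L * (e / N.+1%:R).
  by move=> wBL; have [_ wL] := BL_line x i wBL; exact: (mean_riemann N e0 wL).
have blr : bl (r u) := bl_scale _ (bl_sum a blu).
have n0 : 0 <= N.+1%:R^-1 :> R by rewrite invr_ge0.
have h1 : T (r u) z <= r (T u) z := op_sum sT a n0 blu z.
have h2 := rP (T u) z (op_BL sT uBL).
have h3 := op_dist sT (op_bl sA blu) blr (fun x => rP u x uBL) z.
have -> : 2 * L * e / N.+1%:R = L * (e / N.+1%:R) + L * (e / N.+1%:R) by ring.
move: h2 h3; rewrite !ler_norml => /andP[h2 _] /andP[_ h3].
rewrite lerBlDr in h3; rewrite lerBrDr in h2.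
apply: (le_trans h3); rewrite addrCA lerD2l; apply: (le_trans h1).
by rewrite -lerBlDr addrC.
Qed.

(** Each average is itself a sublinear operator, so [op_stek] gives the inequality in both
    orders. *)
Lemma stekC e i j u : 0 < e -> bl u -> stek e i (stek e j u) = stek e j (stek e i u).
Proof.
move=> e0 blu; apply/funext => z; apply: le_anti; apply/andP; split.
  exact: (op_stek j z (stek_sublinear i e0) e0 blu).
exact: (op_stek i z (stek_sublinear j e0) e0 blu).
Qed.

Lemma stek_local e i u v z : 0 <= e ->
  (forall x, `|x - z| <= e -> u x = v x) -> stek e i u z = stek e i v z.
Proof.
move=> e0 uv; rewrite /stek /mean; congr (_ * _).
apply: eq_Rintegral => t; rewrite inE/= in_itv/= => /andP[t0 te]; apply: uv.
by rewrite addrC addKr normrZ norm_delta mulr1 ger0_norm.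
Qed.

(** Moving the base point slides the window of integration, so only the values at its two ends
    contribute. *)
Lemma is_derive_stek e i u z : 0 < e -> bl u ->
  is_derive z (delta_mx 0 i) (stek e i u)
    (e^-1 * (u (z + e *: delta_mx 0 i) - u z)).
Proof.
move=> e0 [B [L uBL]].
pose g t := u (z + t *: delta_mx 0 i).
have cg : continuous g by exact: BL_continuous (BL_line z i uBL).
(* The margin 2 leaves room for every displacement [h] with [|h| < 1]. *)
have [F dF] := @antiderivative_exists _ g (-2) (e + 2) cg.
pose G h := e^-1 * (F (h + e) - F h).
have GE h : `|h| < 1 -> stek e i u (h *: delta_mx 0 i + z) = G h.
  rewrite ltr_norml => /andP[h1 h2].
  rewrite /G -(@mean_antiderivative _ e h (-2) (e + 2) g F e0)//; try lra.
  rewrite /stek; congr mean; apply/funext => t; rewrite /g.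
  by rewrite scalerDl [h *: _ + z]addrC -addrA [h *: _ + _]addrC.
have dG : is_derive (0:R) 1 G (e^-1 * (g e - g 0)).
  have d1 : is_derive (0:R) 1 F (g 0) by apply: dF; lra.
  have d2 : is_derive (0:R) 1 (F \o (fun h => h + e)) (g e).
    have d3 : is_derive ((0:R) + e) 1 F (g e) by rewrite add0r; apply: dF; lra.
    have := @is_derive1_comp R F (fun h => h + e) 0 (g e) 1 d3 _.
    by rewrite mulr1; apply; apply: is_derive_eq; rewrite addr0.
  have d3 := is_deriveB d2 d1.
  exact: (is_deriveZ e^-1 d3).
have GC : h^-1 *: (stek e i u (h *: delta_mx 0 i + z) - stek e i u z) @[h --> 0^']
    --> e^-1 * (u (z + e *: delta_mx 0 i) - u z).
  have -> : u (z + e *: delta_mx 0 i) - u z = g e - g 0.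
    by rewrite /g scale0r addr0.
  have [dvG <-] := dG.
  have : h^-1 *: (G (h *: 1 + 0) - G 0) @[h --> 0^'] --> 'D_1 G 0 by exact: dvG.
  apply: cvg_trans; apply: near_eq_cvg; near=> h.
  have -> : h *: 1 + 0 = h by rewrite [h *: 1]mulr1 addr0.
  rewrite -(GE 0) ?normr0// scale0r add0r -GE//.
  by near: h; exact: dnbhs0_lt.
by split; [apply/cvg_ex; eexists; exact: GC|exact/cvg_lim].
Unshelve. all: by end_near. Qed.

Definition steks e (w : seq 'I_d) u : E -> R := foldr (stek e) u w.

End steklov.

(** * Iterated averages as a smoothing operator *)

Section smoothing.
Context {R : realType} {d : nat}.
Local Notation E := 'rV[R]_d.
Implicit Types (u v : E -> R) (i j : 'I_d) (e B L c : R) (w : seq 'I_d).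

Lemma steks_sublinear e w : 0 < e -> sublinear_op (@steks R d e w).
Proof.
move=> e0; elim: w => [|i w IH]; first exact: sublinear_op_id.
exact: (sublinear_op_comp (stek_sublinear i e0) IH).
Qed.

Lemma steks_sub e w u v : 0 < e -> bl u -> bl v ->
  steks e w (fun x => u x - v x) = fun z => steks e w u z - steks e w v z.
Proof.
move=> e0 blu blv; elim: w => [//|i w IH] /=; rewrite IH; apply/funext => z.
by apply: stek_sub => //; apply: op_bl => //; exact: steks_sublinear.
Qed.

Lemma steks_close e w B L u z : 0 < e -> BL B L u ->
  `|steks e w u z - u z| <= (size w)%:R * (L * e).
Proof.
move=> e0 uBL; elim: w => [|i w IH] /=; first by rewrite subrr normr0 mul0r.
rewrite -(subrKA (steks e w u z)) (le_trans (ler_normD _ _))//.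
rewrite -natr1 mulrDl mul1r addrC lerD//.
by apply: stek_close => //; apply: op_BL uBL; exact: steks_sublinear.
Qed.

Lemma op_steks T e w u z : sublinear_op T -> 0 < e -> bl u ->
  T (steks e w u) z <= steks e w (T u) z.
Proof.
move=> sT e0 blu; elim: w z => [//|i w IH] z /=.
have sw := steks_sublinear w e0.
apply: le_trans (op_stek i z sT e0 (op_bl sw blu)) _.
by apply: (op_mono (stek_sublinear i e0)) => //; do !apply: op_bl => //.
Qed.

Lemma steks_local e w u v z : 0 <= e ->
  (forall x, `|x - z| <= (size w)%:R * e -> u x = v x) ->
  steks e w u z = steks e w v z.
Proof.
move=> e0; elim: w z => [|i w IH] z uv /=.
  by apply: uv; rewrite subrr normr0 mul0r.
apply: stek_local => // x xz; apply: IH => y yx; apply: uv => /=.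
rewrite -(subrKA x) (le_trans (ler_normD _ _))//.
by rewrite -natr1 mulrDl mul1r lerD.
Qed.

Lemma steks_rem e w i u : 0 < e -> bl u -> i \in w ->
  steks e w u = stek e i (steks e (rem i w) u).
Proof.
move=> e0 blu; elim: w => [//|j w IH]; rewrite inE /=.
have [->//|ij /= iw] := eqVneq j i.
rewrite (IH iw); apply: (stekC j i e0); apply: op_bl => //; exact: steks_sublinear.
Qed.

(** One occurrence of [i] is used up, and the shorter word acts on a difference quotient, again
    bounded and Lipschitz; this drives the induction in [Cb_steks]. *)
Lemma is_derive_steks e w i u z : 0 < e -> bl u -> i \in w ->
  is_derive z (delta_mx 0 i) (steks e w u)
    (steks e (rem i w) (fun x => e^-1 * (u (x + e *: delta_mx 0 i) - u x)) z).
Proof.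
move=> e0 blu iw; rewrite (steks_rem e0 blu iw).
have sw := steks_sublinear (rem i w) e0.
have := is_derive_stek i z e0 (op_bl sw blu); congr is_derive.
rewrite (op_scale sw) ?invr_gt0//; last by apply: bl_sub => //; exact: bl_shift.
congr (_ * _); rewrite steks_sub//; last exact: bl_shift.
by rewrite (op_shift sw).
Qed.

Lemma Cb_steks k e w u : 0 < e -> bl u ->
  (forall i, (k <= count_mem i w)%N) -> Cb k (steks e w u).
Proof.
move=> e0; elim: k w u => [|k IH] w u blu cw.
  have [B [L uBL]] := op_bl (steks_sublinear w e0) blu.
  by split=> //; [case: (BL_Cblip uBL)|exact: BL_continuous uBL].
have [B [L uBL]] := op_bl (steks_sublinear w e0) blu.
split=> [||i]; [by case: (BL_Cblip uBL)|exact: BL_continuous uBL|].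
have iw : i \in w by rewrite -has_pred1 has_count (leq_trans _ (cw i)).
split=> [x|]; first by have [] := is_derive_steks x e0 blu iw.
rewrite (_ : (fun x => _) =
    steks e (rem i w) (fun x => e^-1 * (u (x + e *: delta_mx 0 i) - u x))).
  apply: IH => [|j].
    by apply: bl_scale; apply: bl_sub => //; exact: bl_shift.
  rewrite count_rem iw; move: (cw j); case: (count_mem j w) => // m.
  by move=> km; apply: leq_trans (leq_sub2l m.+1 (leq_b1 _)); rewrite subn1.
by apply/funext => x; have [] := is_derive_steks x e0 blu iw.
Qed.

(* Each Steklov average gains one derivative in its own direction, so three
   averages per coordinate yield [Cb 3]. *)
Definition smooth_word : seq 'I_d := enum 'I_d ++ enum 'I_d ++ enum 'I_d.

Definition smooth e u : E -> R := steks e smooth_word u.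

Lemma smooth_Cb3 e u : 0 < e -> bl u -> Cb 3 (smooth e u).
Proof.
move=> e0 blu; apply: Cb_steks => // i; rewrite !count_cat.
by rewrite !(count_uniq_mem _ (enum_uniq _)) mem_enum.
Qed.

Lemma smooth_sublinear e : 0 < e -> sublinear_op (smooth e).
Proof. exact: steks_sublinear. Qed.

(** Times [e], this is the radius of the ball on which [smooth e u] depends; times [L * e], it is
    the approximation error. *)
Definition nword : R := (size smooth_word)%:R.

Lemma nword_ge0 : 0 <= nword. Proof. exact: ler0n. Qed.

Lemma smooth_close e B L u z : 0 < e -> BL B L u ->
  `|smooth e u z - u z| <= nword * (L * e).
Proof. exact: steks_close. Qed.

Lemma op_smooth T e u z : sublinear_op T -> 0 < e -> bl u ->
  T (smooth e u) z <= smooth e (T u) z.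
Proof. exact: op_steks. Qed.

Lemma smooth_local e u v z : 0 <= e ->
  (forall x, `|x - z| <= nword * e -> u x = v x) -> smooth e u z = smooth e v z.
Proof. exact: steks_local. Qed.

End smoothing.
Arguments nword : clear implicits.

(** * Gluing functions around distant centres *)

Section gluing.
Context {R : realType} {d : nat}.
Local Notation E := 'rV[R]_d.
Implicit Types (B L : R).

Lemma maxr_lipschitz (a b : R) : `|Num.max 0 a - Num.max 0 b| <= `|a - b|.
Proof.
rewrite ler_norml.
case: (ler0P (a - b)) => ?; rewrite /Num.max; do 2 case: ifP => ?; lra.
Qed.

Lemma sup_BL B L (f : nat -> E -> R) : (forall k, BL B L (f k)) ->
  BL B L (fun x => sup (range (fun k => f k x))).
Proof.
move=> fBL.
have hs x : has_sup (range (fun k => f k x)).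
  split; first by exists (f 0%N x), 0%N.
  by exists B => _ [k _ <-]; have [fB _] := fBL k; rewrite (le_trans (ler_norm _)).
have ubd x k : f k x <= sup (range (fun k => f k x)).
  by apply: ub_le_sup; [case: (hs x)|exists k].
have half x y :
    sup (range (fun k => f k x)) <= sup (range (fun k => f k y)) + L * `|x - y|.
  apply: ge_sup; first by case: (hs x).
  move=> _ [k _ <-]; have [_ fL] := fBL k.
  have := fL x y; rewrite ler_norml => /andP[_ h].
  by have := ubd y k; lra.
split=> [x|x y].
  rewrite ler_norml; apply/andP; split.
    apply: le_trans (ubd x 0%N); have [fB _] := fBL 0%N.
    by have := fB x; rewrite ler_norml => /andP[].
  apply: ge_sup; first by case: (hs x).
  by move=> _ [k _ <-]; have [fB _] := fBL k; rewrite (le_trans (ler_norm _)).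
rewrite ler_norml; apply/andP; split; last by have := half x y; lra.
by have := half y x; rewrite distrC; lra.
Qed.

(* The supremum of the translates of the [u k], each cut off by a steep cone
   outside its ball of radius [r]. *)
Lemma glue_translates B L r (u : nat -> E -> R) : (0 < d)%N -> 0 <= r ->
  (forall k, BL B L (u k)) ->
  exists (g : E -> R) (c : nat -> E),
    BL (3 * B) (L + 2 * B) g /\ forall k x, `|x| <= r -> g (c k + x) = u k x.
Proof.
move=> d0 r0 uBL.
have B0 : 0 <= B := BL_ge0 (uBL 0%N).
pose i0 := Ordinal d0.
(* With this spacing, a point within [r] of one centre is at distance at least [r + 1] from all
   others, where their cut-offs vanish. *)
pose c k : E := (k%:R * (2 * r + 2)) *: delta_mx 0 i0.
have cdist k l : k != l -> 2 * r + 1 <= `|c k - c l|.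
  move=> kl; rewrite -scalerBl normrZ norm_delta mulr1 -mulrBl normrM.
  rewrite [`|2 * r + 2|]ger0_norm; last by lra.
  suff : 1 <= `|k%:R - l%:R : R|.
    move=> h; apply: (@le_trans _ _ (1 * (2 * r + 2))); first lra.
    by apply: ler_wpM2r => //; lra.
  case: (ltngtP k l) kl => // kl _.
    rewrite distrC ger0_norm ?subr_ge0 ?ler_nat ?(ltnW kl)//.
    by rewrite lerBrDr nat1r ler_nat.
  rewrite ger0_norm ?subr_ge0 ?ler_nat ?(ltnW kl)//.
  by rewrite lerBrDr nat1r ler_nat.
(* Adding [B] makes the values on the ball nonnegative, so that 0 is neutral for the supremum; the
   slope [2 * B] brings them down to 0 within distance 1 of the ball. *)
pose t k x := Num.max 0 (u k (x - c k) + B - 2 * B * Num.max 0 (`|x - c k| - r)).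
have tBL k : BL (2 * B) (L + 2 * B) (t k).
  have [uB uL] := uBL k; split=> [x|x y].
    have := uB (x - c k); rewrite ler_norml => /andP[? ?].
    have m0 : 0 <= Num.max 0 (`|x - c k| - r) by rewrite le_max lexx.
    have h : 0 <= 2 * B * Num.max 0 (`|x - c k| - r) by rewrite mulr_ge0// mulr_ge0.
    rewrite /t ger0_norm ?le_max ?lexx// ge_max; apply/andP; split; lra.
  apply: (le_trans (maxr_lipschitz _ _)).
  rewrite (_ : _ - _ = (u k (x - c k) - u k (y - c k)) -
     2 * B * (Num.max 0 (`|x - c k| - r) - Num.max 0 (`|y - c k| - r))); last by ring.
  have xy : `|(x - c k) - (y - c k)| = `|x - y|.
    by congr `|_|; rewrite opprB addrA subrK.
  rewrite (le_trans (ler_normB _ _))// [leRHS]mulrDl lerD//.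
    by rewrite -xy.
  rewrite normrM [`|2 * B|]ger0_norm ?mulr_ge0//; apply: ler_wpM2l.
    by rewrite mulr_ge0.
  rewrite (le_trans (maxr_lipschitz _ _))//.
  rewrite (_ : _ - _ = `|x - c k| - `|y - c k|); last by ring.
  by rewrite -xy; exact: ler_dist_dist.
(* Subtracting [B] restores the original values; the bound becomes [2 * B + B]. *)
exists (fun x => sup (range (fun k => t k x)) - B), c; split.
  have [sB sL] := sup_BL tBL; split=> [x|x y].
    rewrite (le_trans (ler_normB _ _))// (ger0_norm B0).
    by have := sB x; lra.
  by rewrite opprB addrA subrK.
move=> k x xr.
have [uB _] := uBL k.
have tk : t k (c k + x) = u k x + B.
  have ckx : c k + x - c k = x by rewrite addrC addKr.
  rewrite /t ckx.
  have -> : Num.max 0 (`|x| - r) = 0 by apply/max_idPl; lra.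
  rewrite mulr0 subr0; apply/max_idPr.
  by have := uB x; rewrite ler_norml => /andP[]; lra.
suff -> : sup (range (fun l => t l (c k + x))) = u k x + B by rewrite addrK.
rewrite -tk; apply/eqP; rewrite eq_le; apply/andP; split.
  apply: ge_sup; first by exists (t 0%N (c k + x)), 0%N.
  move=> _ [l _ <-]; have [->//|lk] := eqVneq l k.
  rewrite {1}/t.
  have far : r + 1 <= `|c k + x - c l|.
    have := cdist _ _ lk; rewrite distrC => h.
    have := ler_normB (c k + x - c l) x.
    by rewrite (addrAC (c k)) addrK; lra.
  have -> : Num.max 0 (`|c k + x - c l| - r) = `|c k + x - c l| - r.
    by apply/max_idPr; lra.
  rewrite ge_max; apply/andP; split; first by rewrite /t le_max lexx.
  have [ulB _] := uBL l; have := ulB (c k + x - c l); rewrite ler_norml => /andP[_ h].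
  have h2 : 2 * B * 1 <= 2 * B * (`|c k + x - c l| - r).
    by apply: ler_wpM2l; [rewrite mulr_ge0|lra].
  apply: (@le_trans _ _ 0); last by rewrite /t le_max lexx.
  lra.
apply: ub_le_sup; last by exists k.
exists (2 * B) => _ [l _ <-]; have [tB _] := tBL l.
by rewrite (le_trans (ler_norm _)).
Qed.

End gluing.

(** * Lipschitz bounds from bounded derivatives, and norm comparisons *)

Section derivative_bounds.
Context {R : realType} {d : nat}.
Local Notation E := 'rV[R]_d.
Implicit Types (phi : E -> R) (x y : E) (i : 'I_d) (B L : R).

Lemma bounded_fun_le (f : E -> R) : bounded_fun (f : E -> R^o) ->
  exists2 B, 0 <= B & forall x, `|f x| <= B.
Proof.
move=> [M [_ fM]]; exists (`|M| + 1) => // x.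
by apply: fM => //; rewrite (le_lt_trans (ler_norm _))// ltrDl.
Qed.

Lemma line_lipschitz phi i B x t :
  (forall z, derivable phi z (delta_mx 0 i : E)) ->
  (forall z, `|'D_(delta_mx 0 i : E) phi z| <= B) ->
  `|phi (x + t *: delta_mx 0 i) - phi x| <= B * `|t|.
Proof.
move=> dphi phiB; pose g (s : R) : R := phi (x + s *: delta_mx 0 i).
pose dg (s : R) : R := 'D_(delta_mx 0 i : E) phi (x + s *: delta_mx 0 i).
have dgP (s : R) : is_derive s (1 : R) g (dg s).
  have [dv] : is_derive (x + s *: delta_mx 0 i) (delta_mx 0 i : E) phi (dg s).
    exact: derivableP.
  have lineE : (fun h : R => h^-1 *: (g (h *: 1 + s) - g s)) =
     (fun h : R => h^-1 *: (phi (h *: delta_mx 0 i + (x + s *: delta_mx 0 i)) -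
       phi (x + s *: delta_mx 0 i))).
    apply/funext => h; rewrite /g [h *: 1]mulr1 scalerDl.
    by rewrite addrCA.
  by move=> dE; split; rewrite /derivable /derive/= -?dE lineE.
have cg : continuous g.
  by move=> s; have [dgs _] := dgP s;
     apply: differentiable_continuous; apply/derivable1_diffP.
have main a b : a <= b -> `|g b - g a| <= B * `|b - a|.
  move=> ab; have [|c _ ->] := @MVT_segment R g dg a b ab (fun s _ => dgP s).
    exact: continuous_subspaceT.
  by rewrite normrM ler_wpM2r// phiB.
have -> : phi x = g 0 by rewrite /g scale0r addr0.
rewrite -[t in leRHS]subr0; have [t0|t0] := leP 0 t; first exact: main.
by rewrite distrC (distrC t); apply: main; exact: ltW.
Qed.

Lemma Cb1_bl phi : Cb 1 phi -> bl phi.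
Proof.
move=> [/bounded_fun_le[B B0 phiB] _ dphi].
have /choice[C CP] : forall i : 'I_d, exists C, 0 <= C /\
    forall x, `|'D_(delta_mx 0 i : E) phi x| <= C.
  by move=> i; have [_ [/bounded_fun_le[C C0 CP] _ _]] := dphi i; exists C.
exists B, (\sum_i C i); split=> // x y.
(* interpolate between [y] and [x] one coordinate at a time *)
pose p k : E := \row_i (if (i < k)%N then x 0 i else y 0 i).
have p0 : p 0%N = y by apply/rowP => i; rewrite mxE ltn0.
have pd : p d = x by apply/rowP => i; rewrite mxE ltn_ord.
rewrite -{1}p0 -{1}pd -(telescope_sumr (fun k => phi (p k)))// big_mkord mulr_suml.
apply: le_trans (ler_norm_sum _ _ _) _; apply: ler_sum => i _.
have -> : p i.+1 = p i + (x 0 i - y 0 i) *: delta_mx 0 i.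
  apply/rowP => j; rewrite !mxE eqxx/= ltnS leq_eqVlt.
  have [->|ij] := eqVneq j i; first by rewrite eqxx ltnn mulr1 addrC subrK.
  by rewrite mulr0 addr0; case: eqP => // /val_inj ji; rewrite ji eqxx in ij.
have [C0 iC] := CP i; have [di _] := dphi i.
apply: le_trans (line_lipschitz _ _ di iC) _; rewrite ler_wpM2l//.
by have := row_norm_ge (x - y) i; rewrite !mxE.
Qed.

Lemma Cb3_bl phi : Cb 3 phi -> bl phi.
Proof.
move=> [bphi cphi dphi]; apply: Cb1_bl; split=> // i.
by have [dp []] := dphi i; split.
Qed.

Lemma row_le_enorm x : `|x| <= enorm x.
Proof.
apply: row_norm_le => [|i]; first exact: sqrtr_ge0.
rewrite -sqrtr_sqr /enorm ler_wsqrtr// /dot (bigD1 i)//= -expr2 lerDl.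
by apply: sumr_ge0 => j _; rewrite -expr2 sqr_ge0.
Qed.

Lemma row_norm_le_mx m (X : 'M[R]_(m, d)) k : `|row k X| <= `|X|.
Proof.
apply: row_norm_le => // i; rewrite mxE.
by rewrite [leRHS]/Num.norm/= mx_normrE; apply/bigmax_geP; right; exists (k, i).
Qed.

End derivative_bounds.

(** * Expectations of partial sums as iterates of an operator *)

Section sums.
Context {R : realType} {d : nat} {Omega : Type} (S : sublinear_space R Omega).
Local Notation E := 'rV[R]_d.
Variable Z : nat -> Omega -> E.
Hypotheses (Z_rv : forall i, random_var S (Z i)) (Z_iid : iid S Z).
Implicit Types (u v : E -> R) (B L c : R) (z : E) (n : nat).

(** With [c] equal to [h^(1/alpha)] this is the one-step operator [T_h]. *)
Definition shift_op c u z : R := Ehat S (fun w => u (z + c *: Z 0%N w)).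

Lemma BL_affine (V : normedModType R) B L u z (f : V -> E) K :
  0 <= K -> BL B L u -> (forall x y, `|f x - f y| <= K * `|x - y|) ->
  Cblip (fun x => u (z + f x)).
Proof.
move=> K0 [uB uL] fK.
apply: (@BL_Cblip _ _ B (`|L| * K)); split=> [//|x y].
apply: (le_trans (uL _ _)); rewrite opprD addrACA subrr add0r -mulrA.
apply: (@le_trans _ _ (`|L| * `|f x - f y|)).
  by apply: ler_wpM2r => //; exact: ler_norm.
exact: ler_wpM2l.
Qed.

Lemma Cblip_scale u c z : bl u -> Cblip (fun x : E => u (z + c *: x)).
Proof.
move=> [B [L uBL]]; apply: (BL_affine (K := `|c|) z _ uBL) => // x y.
by rewrite -scalerBr normrZ.
Qed.

Lemma dom_shift u c z : bl u -> dom S (fun w => u (z + c *: Z 0%N w)).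
Proof. by move=> blu; exact: (@Z_rv 0%N _ (Cblip_scale c z blu)). Qed.

Lemma shift_op_sublinear c : sublinear_op (shift_op c).
Proof.
split.
- by move=> u v blu blv uv x; apply: Ehat_mono => //; exact: dom_shift.
- by move=> u v blu blv x; apply: Ehat_subadd => //; exact: dom_shift.
- by move=> b u b0 blu x; apply: Ehat_scale => //; exact: dom_shift.
- by move=> a u x; congr Ehat; apply/funext => w; rewrite addrAC.
- by move=> b x; exact: Ehat_cst.
Qed.

Lemma same_law0 n u : Cblip u -> Ehat S (u \o Z n) = Ehat S (u \o Z 0%N).
Proof.
move=> uC; elim: n => [//|n IH]; rewrite -IH.
by have [sl _] := Z_iid n; exact: sl.
Qed.

Lemma psumS n w : psum Z n.+1 w = psum Z n w + Z n w.
Proof. by rewrite /psum big_ord_recr. Qed.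

(** The shape to which [independent] applies: a function of the tuple of the first [n + 1] terms and
    of the next term. *)
Let joint c u z n (p : 'M[R]_(n.+1, d) * E) : R :=
  u (z + c *: (\sum_k row k p.1 + p.2)).

Let joint_Cblip c u z n : bl u -> Cblip (@joint c u z n).
Proof.
move=> [B [L uBL]].
(* Each of the [n + 1] rows and the last vector has norm at most that of the pair. *)
have K0 : 0 <= `|c| * n.+2%:R by rewrite mulr_ge0.
apply: (BL_affine z K0 uBL (f := fun p : 'M[R]_(n.+1, d) * E =>
  c *: (\sum_k row k p.1 + p.2))) => -[X x] [Y y] /=.
rewrite -scalerBr normrZ -mulrA ler_wpM2l// opprD addrACA -sumrB.
apply: le_trans (ler_normD _ _) _.
rewrite -natr1 mulrDl mul1r lerD//; last by rewrite prod_normE/= le_max lexx orbT.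
apply: le_trans (ler_norm_sum _ _ _) _.
rewrite -[X in X%:R * _]card_ord mulr_natl -sumr_const; apply: ler_sum => k _.
rewrite -linearB/= (le_trans (row_norm_le_mx _ _))//.
by rewrite prod_normE/= le_max lexx.
Qed.

Let jointE c u z n w w' : joint c u z (tupleR Z n w, Z n.+1 w') =
  u (z + c *: (psum Z n.+1 w + Z n.+1 w')).
Proof.
rewrite /joint/= /psum; congr (u (z + _ *: (_ + _))); apply: eq_bigr => k _.
by apply/rowP => j; rewrite !mxE.
Qed.

Lemma dom_psum u c z n : bl u -> dom S (fun w => u (z + c *: psum Z n w)).
Proof.
move=> blu; case: n => [|[|n]].
- rewrite (_ : (fun w => _) = (fun=> u z)); first exact: dom_cst.
  by apply/funext => w; rewrite /psum big_ord0 scaler0 addr0.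
- rewrite (_ : (fun w => _) = (fun w => u (z + c *: Z 0%N w))).
    exact: dom_shift.
  by apply/funext => w; rewrite /psum big_ord1.
- have [_ [rv _]] := Z_iid n.
  have := rv _ (@joint_Cblip c u z n blu); congr (dom S _).
  by apply/funext => w; rewrite /= jointE -psumS.
Qed.

(** Independence freezes the first terms and averages over the last, which replaces [u] by
    [shift_op c u]; the shorter sum is then handled by induction with this new function. *)
Lemma Ehat_psum u c z n : bl u ->
  Ehat S (fun w => u (z + c *: psum Z n w)) = iter n (shift_op c) u z.
Proof.
elim: n u => [|n IH] u blu.
  rewrite (_ : (fun w => _) = (fun=> u z)) ?Ehat_cst//.
  by apply/funext => w; rewrite /psum big_ord0 scaler0 addr0.
(* Independence concerns nonempty tuples, so a single summand is a base case. *)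
case: n IH => [_|n IH].
  by congr Ehat; apply/funext => w; rewrite /psum big_ord1.
rewrite iterSr -IH; last by apply: op_bl => //; exact: shift_op_sublinear.
have [_ [_ ind]] := Z_iid n.
have := ind _ (@joint_Cblip c u z n blu).
rewrite (_ : (fun w => joint _ _ _ _) = (fun w => u (z + c *: psum Z n.+2 w))).
  move=> ->; congr Ehat; apply/funext => w.
  transitivity (Ehat S ((fun x => u (z + c *: psum Z n.+1 w + c *: x)) \o Z n.+1)).
    by congr Ehat; apply/funext => w'; rewrite /= jointE scalerDr addrA.
  by rewrite same_law0//; exact: Cblip_scale.
by apply/funext => w; rewrite jointE -psumS.
Qed.

Hypothesis S_dom : forall n, dom S (fun w => enorm (psum Z n w)).

Lemma Ehat_scale0 c X : dom S X -> 0 <= c -> Ehat S (fun w => c * X w) = c * Ehat S X.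
Proof.
move=> dX; rewrite le_eqVlt => /predU1P[<-|c0]; last exact: Ehat_scale.
by rewrite mul0r; under eq_fun do rewrite mul0r; rewrite Ehat_cst.
Qed.

(** The increment of [u] is dominated by [Y], a multiple of the norm of the partial sum. The lower
    bound uses [u z <= X + Y] and subadditivity, so that no expectation of [- Y] appears. *)
Lemma iter_shift_close B L u c z n : 0 <= c -> 0 <= L -> BL B L u ->
  `|iter n (shift_op c) u z - u z| <= L * (c * Ehat S (fun w => enorm (psum Z n w))).
Proof.
move=> c0 L0 uBL; have blu := BL_bl uBL; have [uB uL] := uBL.
rewrite -Ehat_psum// mulrA; have Lc : 0 <= L * c by rewrite mulr_ge0.
rewrite -Ehat_scale0//; set X := fun w => _; set Y := fun w => L * c * _.
have dX : dom S X by exact: dom_psum.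
have dY : dom S Y by exact: dom_scale.
have XY w : `|X w - u z| <= Y w.
  rewrite /X /Y (le_trans (uL _ _))// addrAC subrr add0r normrZ ger0_norm//.
  by rewrite -mulrA ler_wpM2l// ler_wpM2l// row_le_enorm.
rewrite ler_distl; apply/andP; split.
  rewrite lerBlDr -{1}(Ehat_cst S (u z)).
  apply: le_trans (Ehat_subadd dX dY); apply: Ehat_mono => //.
  - exact: dom_cst.
  - exact: dom_add.
  - by move=> w; have := XY w; rewrite ler_distl => /andP[]; lra.
rewrite -(Ehat_cst S (u z)).
apply: le_trans (Ehat_subadd (dom_cst S _) dY); apply: Ehat_mono => //.
- by apply: dom_add => //; exact: dom_cst.
- by move=> w; have := XY w; rewrite ler_distl => /andP[]; lra.
Qed.

End sums.

(** * Comparison of two schemes through smoothing *)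

Section comparison.
Context {R : realType} {d : nat}.
Local Notation E := 'rV[R]_d.
Implicit Types (u v : E -> R).

(** In [main], [smooth e (iter k T u)] acts as a supersolution for [Q]: on a smoothed function [Q]
    is replaced by [T] at cost [eta], then [op_smooth] moves [T] under the smoothing. The remaining
    error removes the smoothing at the start and at the end. *)
Lemma iter_smooth_le (Q T : (E -> R) -> E -> R) (B L e eta : R) u n z :
  sublinear_op Q -> sublinear_op T -> 0 < e ->
  (forall v, BL B L v -> forall x, Q (smooth e v) x <= T (smooth e v) x + eta) ->
  BL B L u ->
  iter n Q u z <= iter n T u z + 2 * (nword R d * (L * e)) + n%:R * eta.
Proof.
move=> sQ sT e0 QT uBL; have blu := BL_bl uBL.
have sP := @smooth_sublinear R d e e0.
have iBL k : BL B L (iter k T u) by apply: op_BL uBL; exact: sublinear_op_iter.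
have main k x : iter k Q (smooth e u) x <= smooth e (iter k T u) x + k%:R * eta.
  elim: k x => [|k IH] x /=; first by rewrite mul0r addr0.
  have blQ : bl (iter k Q (smooth e u)).
    by apply: op_bl; [exact: sublinear_op_iter|exact: op_bl].
  have blP : bl (smooth e (iter k T u)) by apply: op_bl => //; exact: BL_bl (iBL k).
  have h1 := op_le_addr sQ blQ blP IH x.
  have h2 := QT _ (iBL k) x.
  have h3 := op_smooth x sT e0 (BL_bl (iBL k)).
  by rewrite -natr1 mulrDl mul1r; lra.
have uP x : `|u x - smooth e u x| <= nword R d * (L * e).
  by rewrite distrC; exact: (smooth_close x e0 uBL).
have h1 := op_dist (sublinear_op_iter n sQ) blu (op_bl sP blu) uP z.
have h2 := main n z.
have h3 := smooth_close z e0 (iBL n).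
have {}h1 := le_trans (ler_norm _) h1; have {}h3 := le_trans (ler_norm _) h3.
lra.
Qed.

End comparison.

Lemma uniform_cauchy_limit {R : realType} (I : Type) (X : nat -> I -> R) :
  (forall eps, 0 < eps -> exists N : nat, forall n m z, (N <= n)%N -> (N <= m)%N ->
     `|X n z - X m z| <= eps) ->
  exists e : I -> R, forall eps, 0 < eps -> exists N : nat, forall n z,
    (N <= n)%N -> `|X n z - e z| <= eps.
Proof.
move=> XC; exists (fun z => lim (X n z @[n --> \oo])) => eps eps0.
have cX z : cvg (X n z @[n --> \oo]).
  apply/cauchy_cvgP/cauchy_exP => d d0; have d2 : 0 < d / 2 by rewrite divr_gt0.
  have [N NP] := XC _ d2; exists (X N z); exists N => // n /= Nn.
  by rewrite /ball/= (le_lt_trans (NP N n z (leqnn _) Nn))// ltr_pdivrMr// ltr_pMr// ltr1n.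
have [N NP] := XC eps eps0; exists N => n z Nn; apply/ler_addgt0Pr => d d0.
have /cvgrPdist_le/(_ d d0)[N' _ N'P] := cX z.
have h1 := N'P (maxn N N') (leq_maxr _ _).
have h2 := NP n (maxn N N') z Nn (leq_maxl _ _).
apply: le_trans (ler_distD (X (maxn N N') z) _ _) _.
by apply: lerD => //; rewrite distrC.
Qed.

(** * Convergence of a consistent scheme with scaling and moment bounds *)

Section scheme.
Context {R : realType} {d : nat}.
Local Notation E := 'rV[R]_d.
Implicit Types (u v f g phi : E -> R) (h s sg e eta B L : R) (z : E).

Variable T : R -> (E -> R) -> E -> R.
Variables (alpha p M : R).
Hypothesis alpha1 : 1 < alpha.
Hypothesis p0 : 0 < p.
Hypothesis M0 : 0 <= M.
Hypothesis sT : forall h, sublinear_op (T h).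
Hypothesis T_scale : forall h r u, 0 < h -> 0 < r -> bl u ->
  T h (fun x => u (r^-1 *: x)) 0 = T (h * r `^ (- alpha)) u 0.
Hypothesis T_moment : forall B L h n u z, 0 < h -> 0 <= L -> BL B L u ->
  `|iter n (T h) u z - u z| <= L * (M * (n%:R * h) `^ p).

Definition quot h u z : R := h^-1 * (T h u z - u z).

Hypothesis consistent : forall phi, Cb 3 phi -> exists (A : E -> R) (l : R -> R),
  (forall eta, 0 < eta -> exists2 s0, 0 < s0 & forall s, 0 < s <= s0 -> l s <= eta) /\
  forall s z, 0 < s <= 1 -> `|quot s phi z - A z| <= l s.

Lemma quotE h u z : 0 < h -> T h u z = u z + h * quot h u z.
Proof. by move=> h0; rewrite /quot mulrA divff ?gt_eqF// mul1r addrC subrK. Qed.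

Lemma quot_BL B L h u : 0 < h -> BL B L u ->
  BL (h^-1 * (2 * B)) (h^-1 * (2 * L)) (quot h u).
Proof.
move=> h0 uBL; have := BL_scale h^-1 (BL_add (op_BL (sT h) uBL) (BL_scale (-1) uBL)).
have hi : `|h^-1| = h^-1 by rewrite gtr0_norm ?invr_gt0.
have aE (a : R) : a + `|-1| * a = 2 * a by rewrite normrN normr1; ring.
rewrite hi !aE; congr BL; apply/funext => x.
by rewrite /quot mulN1r.
Qed.

(** Telescoping: up to sublinearity, [T^(k+1) u - T^k u] is [T^k] applied to [T u - u], that is, to
    about [h * psi]. Since [psi] is a quotient at the fixed scale [sg], its Lipschitz constant does
    not blow up as [h] decreases, and [T_moment] shows that [T^k] hardly changes it. *)
Lemma iter_expansion B L u h sg eta m z : 0 < h -> 0 < sg -> 0 <= L -> BL B L u ->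
  (forall x, `|quot h u x - quot sg u x| <= eta) ->
  `|iter m (T h) u z - u z - m%:R * h * quot sg u z| <=
     m%:R * h * (eta + sg^-1 * (2 * L) * (M * (m%:R * h) `^ p)).
Proof.
move=> h0 sg0 L0 uBL hs; have blu := BL_bl uBL.
set psi := quot sg u.
have psiBL : BL _ _ psi := quot_BL sg0 uBL.
set Lp := sg^-1 * (2 * L).
have Lp0 : 0 <= Lp by rewrite mulr_ge0 ?invr_ge0 ?(ltW sg0)// mulr_ge0.
set C := Lp * _.
have step k x : (k < m)%N ->
    `|iter k.+1 (T h) u x - iter k (T h) u x - h * psi x| <= h * (eta + C).
  move=> km; have sk := sublinear_op_iter k (sT h).
  have blT : bl (T h u) by exact: op_bl (sT h) _ blu.
  have kC f : BL (sg^-1 * (2 * B)) Lp f -> iter k (T h) f x <= f x + C.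
    move=> fBL; have := T_moment k x h0 Lp0 fBL.
    have : Lp * (M * (k%:R * h) `^ p) <= C.
      apply: ler_wpM2l => //; apply: ler_wpM2l => //.
      apply: ge0_ler_powR; rewrite ?nnegrE ?mulr_ge0 ?(ltW h0) ?(ltW p0)//.
      by rewrite ler_pM2r// ler_nat ltnW.
    by rewrite ler_norml => ? /andP[_ ?]; lra.
  (* [T^k] is only sublinear, so the lower bound goes through [- psi]. *)
  have psiN : BL (sg^-1 * (2 * B)) Lp (fun y => -1 * psi y).
    by have := BL_scale (-1) psiBL; rewrite normrN normr1 !mul1r.
  have up f : BL (sg^-1 * (2 * B)) Lp f -> forall g, bl g ->
      (forall y, g y <= h * (f y + eta)) ->
      iter k (T h) g x <= h * (f x + C + eta).
    move=> fBL g blg gf; have blf := BL_bl fBL.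
    have blfe := bl_add blf (bl_cst eta).
    apply: le_trans (op_mono sk blg (bl_scale h blfe) gf x) _.
    rewrite (op_scale sk h0 blfe) ler_pM2l// (op_addc sk eta blf) lerD2r.
    exact: kC.
  have h1 := op_sub sk blT blu x.
  have h2 := op_sub sk blu blT x.
  have h3 := up psi psiBL _ (bl_sub blT blu) _.
  have h4 := up _ psiN _ (bl_sub blu blT) _.
  have TuE y : T h u y - u y = h * quot h u y.
    by rewrite (quotE _ _ h0) addrC addKr.
  have hs' y : - eta <= quot h u y - psi y <= eta by rewrite -ler_norml.
  rewrite iterSr ler_norml; apply/andP; split.
    have : iter k (T h) (fun y => u y - T h u y) x <= h * (-1 * psi x + C + eta).
      apply: h4 => y; rewrite -opprB TuE -mulrN ler_pM2l//.
      by have /andP[] := hs' y; lra.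
    lra.
  have : iter k (T h) (fun y => T h u y - u y) x <= h * (psi x + C + eta).
    apply: h3 => y; rewrite TuE ler_pM2l//.
    by have /andP[] := hs' y; lra.
  lra.
suff main k x : (k <= m)%N ->
  `|iter k (T h) u x - u x - k%:R * h * psi x| <= k%:R * h * (eta + C) by exact: main.
elim: k => [|k IH] km; first by rewrite !mul0r !subr0 subrr normr0.
have h1 := step k x km; have h2 := IH (ltnW km).
rewrite (_ : _ - _ = (iter k.+1 (T h) u x - iter k (T h) u x - h * psi x) +
   (iter k (T h) u x - u x - k%:R * h * psi x)); last first.
  by rewrite -natr1; ring.
apply: (le_trans (ler_normD _ _)); rewrite -natr1 !mulrDl mul1r addrC.
by rewrite -!mulrDl in h2 *; rewrite addrC; lra.
Qed.


Lemma bl_dilate c u : bl u -> bl (fun x : E => u (c *: x)).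
Proof.
move=> [B [L [uB uL]]]; exists B, (`|L| * `|c|); split=> [//|x y].
apply: (le_trans (uL _ _)); rewrite -scalerBr normrZ mulrA.
by do 2 apply: ler_wpM2r => //; exact: ler_norm.
Qed.

Lemma bump_exists : exists tau : E -> R, [/\ Cb 3 tau, bl tau, tau 0 = 0,
  forall x, 0 <= tau x & forall x, 1 <= `|x| -> tau x = 1].
Proof.
(* Then [theta] is 0 up to norm 1/4 and 1 from norm 1/2 on. *)
pose m (x : E) : R := Num.max 0 (4 * `|x| - 1).
pose theta (x : E) : R := 1 - Num.max 0 (1 - m x).
have m0 x : 0 <= m x by rewrite le_max lexx.
have theta01 x : 0 <= theta x <= 1.
  have h1 : 0 <= Num.max 0 (1 - m x) by rewrite le_max lexx.
  have h2 : Num.max 0 (1 - m x) <= 1.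
    by have := m0 x; rewrite ge_max => ?; apply/andP; split; lra.
  by apply/andP; split; rewrite /theta; lra.
have thetaBL : BL 1 4 theta.
  split=> [x|x y]; first by have := theta01 x; rewrite ler_norml; lra.
  have -> : theta x - theta y = Num.max 0 (1 - m y) - Num.max 0 (1 - m x).
    by rewrite /theta; ring.
  apply: (le_trans (maxr_lipschitz _ _)).
  have -> : 1 - m y - (1 - m x) = m x - m y by ring.
  apply: (le_trans (maxr_lipschitz _ _)).
  have -> : 4 * `|x| - 1 - (4 * `|y| - 1) = 4 * (`|x| - `|y|) by ring.
  by rewrite normrM (ger0_norm (ler0n _ 4)) ler_wpM2l// ler_dist_dist.
have theta0 x : `|x| <= 4^-1 -> theta x = 0.
  move=> x4; rewrite /theta (_ : m x = 0); last by apply/max_idPl; lra.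
  by rewrite subr0 (_ : Num.max 0 1 = 1) ?subrr//; apply/max_idPr; lra.
have theta1 x : 2^-1 <= `|x| -> theta x = 1.
  move=> x4; have m1 : 1 <= m x by rewrite le_max; apply/orP; right; lra.
  by rewrite /theta (_ : Num.max 0 _ = 0) ?subr0//; apply/max_idPl; lra.
have N0 := @nword_ge0 R d.
(* The smoothing radius [nword R d * e] is at most 1/8, within the margins left by [theta]. *)
pose e : R := (8 * (nword R d + 1))^-1.
have e0 : 0 < e by rewrite invr_gt0; lra.
have Ne : nword R d * e <= 8^-1.
  rewrite /e invfM mulrCA; apply: ler_piMr; first by rewrite invr_ge0.
  by rewrite ler_pdivrMr ?mul1r; lra.
have sP := @smooth_sublinear R d e e0.
have blt := BL_bl thetaBL.
exists (smooth e theta); split.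
- exact: smooth_Cb3.
- exact: op_bl.
- rewrite (@smooth_local _ _ e theta (fun=> 0)) ?op_cst ?ltW// => x.
  by rewrite subr0 => xe; apply: theta0; lra.
- move=> x; rewrite -(op_cst sP 0 x).
  apply: (op_mono sP) => //; first exact: bl_cst.
  by move=> y; have /andP[] := theta01 y.
- move=> x x1; rewrite (@smooth_local _ _ e theta (fun=> 1)) ?op_cst ?ltW// => y yx.
  apply: theta1; have := lerB_dist x (x - y); rewrite subKr distrC.
  by have := lerB_dist x y; rewrite distrC; lra.
Qed.

(** The difference of [f] and [g] lies below [C * tau (x / r)], with [tau] the cut-off of
    [bump_exists]. By scaling, [T h] of this dilation at 0 is [T] with step [h * r^(- alpha)] on
    [tau], which consistency for the single function [tau] bounds by [K] times that step. *)
Lemma quot_tail : exists K s1 : R, [/\ 0 <= K, 0 < s1 <= 1 &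
  forall C r h f g, 1 <= r -> 0 < h <= s1 -> bl f -> bl g -> f 0 = g 0 ->
    (forall x, `|f x - g x| <= C) -> (forall x, `|x| <= r -> f x = g x) ->
    `|quot h f 0 - quot h g 0| <= C * K / r].
Proof.
have [tau [tauC blt tau0 tau_ge0 tau1]] := bump_exists.
have [A [l [/(_ 1 ltr01)[s0 s00 ls0] Al]]] := consistent tauC.
pose K := `|A 0| + 1.
have K0 : 0 <= K by rewrite addr_ge0.
exists K, (Num.min 1 s0); split=> //.
  by rewrite lt_min ltr01 s00 ge_min lexx.
move=> C r h f g r1 /andP[h0]; rewrite le_min => /andP[h1 hs0] blf blg fg0 fgC fgr.
have r0 : 0 < r by lra.
have C0 : 0 <= C := le_trans (normr_ge0 _) (fgC 0).
have tauK s : 0 < s <= s0 -> s <= 1 -> T s tau 0 <= s * K.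
  move=> /andP[s0' ss0] s1; have s01 : 0 < s <= 1 by rewrite s0'.
  have := Al s 0 s01; have lss : l s <= 1 by apply: ls0; rewrite s0'.
  rewrite (quotE _ _ s0') tau0 add0r ler_pM2l// ler_distl => /andP[_ h2].
  by rewrite /K; have := ler_norm (A 0); lra.
(* Here [1 < alpha] and [1 <= r] enter. *)
have rr : r `^ (- alpha) <= r^-1.
  by rewrite -powR_inv1 ?(ltW r0)//; apply: ler_powR => //; rewrite lerN2 ltW.
have rr0 : 0 < r `^ (- alpha) by exact: powR_gt0.
have rr1 : r `^ (- alpha) <= 1.
  by apply: (le_trans rr); rewrite invf_le1.
pose taur x := C * tau (r^-1 *: x).
have bltr : bl (fun x : E => tau (r^-1 *: x)) by exact: bl_dilate.
have Ttaur : T h taur 0 <= h * (C * K / r).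
  rewrite /taur (op_scale0 (sT h) C0 bltr) (T_scale h0 r0 blt).
  have hr : h * r `^ (- alpha) <= h by rewrite ger_pMr.
  have hK : T (h * r `^ (- alpha)) tau 0 <= h * r `^ (- alpha) * K.
    by apply: tauK; [apply/andP; split; [rewrite mulr_gt0|lra]|lra].
  have -> : h * (C * K / r) = C * (h * r^-1 * K) by ring.
  apply: ler_wpM2l => //; apply: (le_trans hK); apply: ler_wpM2r => //.
  by rewrite ler_pM2l.
have half u v : bl u -> bl v -> (forall x, `|u x - v x| <= C) ->
    (forall x, `|x| <= r -> u x = v x) -> T h u 0 - T h v 0 <= h * (C * K / r).
  move=> blu blv uvC uvr; apply: le_trans (op_sub (sT h) blu blv 0) _.
  apply: le_trans Ttaur; apply: (op_mono (sT h)).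
  - exact: bl_sub.
  - exact: bl_scale.
  - move=> x; have [xr|xr] := leP `|x| r.
      by rewrite uvr// subrr mulr_ge0.
    have xr1 : 1 <= `|r^-1 *: x|.
      by rewrite normrZ gtr0_norm ?invr_gt0// ler_pdivlMl// mulr1 ltW.
    rewrite /taur (tau1 _ xr1) mulr1.
    exact: (le_trans (ler_norm _) (uvC x)).
rewrite /quot -mulrBr fg0 opprB addrA subrK normrM gtr0_norm ?invr_gt0//.
rewrite ler_pdivrMl// ler_norml; apply/andP; split; last exact: half.
rewrite lerNl opprB; apply: half => // x; first by rewrite distrC.
by move=> /fgr.
Qed.

Lemma quot_addl h u (a : E) : quot h u a = quot h (fun x => u (a + x)) 0.
Proof.
rewrite /quot addr0; congr (_ * (_ - _)).
rewrite -[in LHS](add0r a) -(op_shift (sT h)).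
by congr (T h _ 0); apply/funext => x; rewrite addrC.
Qed.

Hypothesis d0 : (0 < d)%N.

(* Gliding hump: glue violating functions around far centres, smooth, and apply
   the consistency hypothesis to the resulting single test function. *)
Lemma quot_smooth_uniform B L e eta : 0 < e -> 0 < eta ->
  exists2 s0, 0 < s0 <= 1 & forall h h' u z, 0 < h <= s0 -> 0 < h' <= s0 ->
    BL B L u -> `|quot h (smooth e u) z - quot h' (smooth e u) z| <= eta.
Proof.
move=> e0 eta0; apply: contrapT => /forall2NP bad.
(* The claim fails at each threshold [1 / (k + 1)], which gives a sequence of violations. *)
have {bad}/choice[q qP] : forall k : nat, exists q : R * R * (E -> R) * E,
    [/\ 0 < q.1.1.1 <= k.+1%:R^-1, 0 < q.1.1.2 <= k.+1%:R^-1, BL B L q.1.2 &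
      eta < `|quot q.1.1.1 (smooth e q.1.2) q.2 -
              quot q.1.1.2 (smooth e q.1.2) q.2|].
  move=> k; apply: contrapT => nq.
  have [|] := bad k.+1%:R^-1.
    by apply; rewrite invr_gt0 ltr0n invf_le1 ?ler1n.
  apply => h h' u z hk hk' uBL; rewrite leNgt; apply/negP => lt.
  by apply: nq; exists (h, h', u, z).
pose hh k := (q k).1.1.1; pose hh' k := (q k).1.1.2.
pose u k x := (q k).1.2 (x + (q k).2).
have uBL k : BL B L (u k) by have [_ _ h _] := qP k; exact: BL_shift.
have sP := @smooth_sublinear R d e e0.
have [K [s1 [K0 /andP[s10 s11] tail]]] := quot_tail.
have B0 : 0 <= B := BL_ge0 (uBL 0%N).
have N0 := @nword_ge0 R d.
(* The glued function is bounded by [3 * B], hence within [4 * B] of each [u k]; this [r] makes the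
   tail error [4 * B * K / r] at most [eta / 8]. *)
pose r := 1 + 4 * B * K * (8 / eta).
have r1 : 1 <= r.
  by rewrite /r lerDl; do !apply: mulr_ge0 => //; rewrite invr_ge0 ltW.
(* With the margin [nword R d * e], the smoothed functions still agree up to radius [r]. *)
have [|g [c [gBL gu]]] := glue_translates (r := r + nword R d * e) d0 _ uBL.
  by apply: addr_ge0; [lra|rewrite mulr_ge0// ltW].
(* The rate [l] belongs to the one function [g], hence serves every centre [c k]. *)
have [A [l [ls Al]]] := consistent (smooth_Cb3 e0 (BL_bl gBL)).
have [|s2 s20 ls2] := ls (eta / 8); first by rewrite divr_gt0.
pose s := Num.min s1 s2.
have sgt0 : 0 < s by rewrite lt_min s10 s20.
pose k := Num.bound s^-1.
have ks : k.+1%:R^-1 <= s.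
  rewrite -[leRHS]invrK lef_pV2 ?posrE ?ltr0n ?invr_gt0//.
  have := @archi_boundP R s^-1; rewrite invr_ge0 => /(_ (ltW sgt0)) /ltW h.
  by apply: (le_trans h); rewrite ler_nat.
have ss : s <= s1 /\ s <= s2 by split; rewrite ge_min lexx ?orbT.
have [hk hk' _] := qP k.
have blg := BL_bl gBL; have blu := BL_bl (uBL k).
pose G x := smooth e g (c k + x).
have GC : bl G.
  have := bl_shift (c k) (op_bl sP blg).
  by congr bl; apply/funext => x; rewrite /G addrC.
have near_eq x : `|x| <= r -> G x = smooth e (u k) x.
  move=> xr; rewrite /G addrC -(op_shift sP); apply: smooth_local; first exact: ltW.
  move=> y yx; rewrite addrC gu//.
  have := ler_normD (y - x) x; rewrite subrK => h1.
  by apply: (le_trans h1); rewrite addrC lerD.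
have diff x : `|G x - smooth e (u k) x| <= 4 * B.
  have [GB _] := op_BL sP gBL; have [uB _] := op_BL sP (uBL k).
  have := GB (c k + x); have := uB x => h1 h2.
  by rewrite (le_trans (ler_normB _ _))//; rewrite -/(G x) in h2; lra.
have G0 : G 0 = smooth e (u k) 0 by apply: near_eq; rewrite normr0; lra.
have tailr : 4 * B * K / r <= eta / 8.
  have r0 : 0 < r by lra.
  rewrite ler_pdivrMr// /r mulrDr mulr1.
  have -> : eta / 8 * (4 * B * K * (8 / eta)) = 4 * B * K.
    by field; rewrite gt_eqF.
  by rewrite lerDr divr_ge0// ltW.
(* Both quotients of the violation are close to the same [A (c k)], with [eta / 8] from the tail and
   [eta / 8] from consistency. *)
have key t : 0 < t <= k.+1%:R^-1 ->
    `|quot t (smooth e (u k)) 0 - A (c k)| <= eta / 4.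
  move=> /andP[t0 tk]; have [ss1 ss2] := ss.
  have ts1 : 0 < t <= s1 by rewrite t0 (le_trans tk)// (le_trans ks).
  have ts2 : 0 < t <= s2 by rewrite t0 (le_trans tk)// (le_trans ks).
  have t1 : 0 < t <= 1 by rewrite t0; case/andP: ts1 => _ /le_trans; apply.
  have h1 : `|quot t G 0 - quot t (smooth e (u k)) 0| <= eta / 8.
    apply: le_trans tailr; by apply: tail => //; exact: op_bl.
  have h2 : `|quot t (smooth e g) (c k) - A (c k)| <= eta / 8.
    exact: le_trans (Al t (c k) t1) (ls2 t ts2).
  rewrite quot_addl -/G in h2.
  have := ler_distD (quot t G 0) (quot t (smooth e (u k)) 0) (A (c k)).
  by rewrite (distrC _ (quot t G 0)); lra.
have qE t : quot t (smooth e (q k).1.2) (q k).2 = quot t (smooth e (u k)) 0.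
  rewrite quot_addl; congr (quot t _ 0); apply/funext => x.
  by rewrite /u (op_shift sP) addrC.
rewrite !qE; have := key _ hk; have := key _ hk'; rewrite !ler_distl.
move=> /andP[? ?] /andP[? ?]; apply/negP; rewrite -leNgt ler_distl.
by apply/andP; split; lra.
Qed.


Lemma powR_small (c : R) : 0 < c -> exists2 r, 0 < r & forall h, 0 <= h <= r -> h `^ p <= c.
Proof.
move=> c0; exists (c `^ p^-1) => [|h /andP[h0 hr]]; first exact: powR_gt0.
have -> : c = (c `^ p^-1) `^ p.
  by rewrite -powRrM mulVf ?gt_eqF// powRr1// ltW.
by apply: ge0_ler_powR => //; rewrite ?nnegrE ?powR_ge0// ltW.
Qed.

Lemma step_small (r : R) : 0 < r -> exists N : nat, forall n s, (N <= n)%N ->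
  0 < s <= 1 -> 0 < s / n.+1%:R <= r.
Proof.
move=> r0; exists (Num.bound r^-1) => n s Nn /andP[s0 s1].
rewrite divr_gt0//= ler_pdivrMr//; apply: (le_trans s1).
have := @archi_boundP R r^-1; rewrite invr_ge0 => /(_ (ltW r0)) /ltW h.
rewrite -ler_pdivrMl// mulr1; apply: (le_trans h); rewrite ler_nat.
exact: (leq_trans Nn).
Qed.

(** One step [h] is compared with [m + 1] steps [h' = h / (m + 1)]: on smoothed functions both
    follow the expansion with [quot sg], and [iter_smooth_le] in both directions carries this over
    all steps. [N] does not depend on [m], which allows common refinements. *)
Lemma iter_refine B L s eps : 0 <= L -> 0 < s <= 1 -> 0 < eps ->
  exists N : nat, forall n m u z, (N <= n)%N -> BL B L u ->
    `|iter n.+1 (T (s / n.+1%:R)) u z -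
      iter (n.+1 * m.+1) (T (s / (n.+1 * m.+1)%:R)) u z| <= eps.
Proof.
move=> L0 s01 eps0; have N0 := @nword_ge0 R d.
(* Chosen so that smoothing at both ends costs at most [eps / 2]. *)
pose e := eps / (4 * (nword R d * L + 1)).
have NL0 : 0 <= nword R d * L by rewrite mulr_ge0.
have e0 : 0 < e by rewrite divr_gt0//; lra.
have eN : 2 * (nword R d * (L * e)) <= eps / 2.
  have -> : 2 * (nword R d * (L * e)) =
      (nword R d * L) / (nword R d * L + 1) * (eps / 2).
    by rewrite /e; field; rewrite gt_eqF//; lra.
  apply: ler_piMl; first by rewrite divr_ge0// ltW.
  by rewrite ler_pdivrMr; lra.
have eps8 : 0 < eps / 8 by rewrite divr_gt0.
have [sg /andP[sg0 sg1] unif] := quot_smooth_uniform B L e0 eps8.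
pose C := sg^-1 * (2 * L) * M.
have C0 : 0 <= C by rewrite !mulr_ge0// invr_ge0 ltW.
have [|r r0 rP] := @powR_small (eps / 8 / (C + 1)).
  by rewrite divr_gt0//; lra.
have [|N NP] := @step_small (Num.min sg r); first by rewrite lt_min sg0 r0.
exists N => n m u z Nn uBL.
have s0 : 0 < s by case/andP: s01.
set h := s / n.+1%:R; set h' := s / (n.+1 * m.+1)%:R.
have /andP[h0] := NP n s Nn s01; rewrite -/h le_min => /andP[hsg hr].
have hh' : h = m.+1%:R * h'.
  rewrite /h /h' natrM.
  have : m.+1%:R != 0 :> R by rewrite pnatr_eq0.
  have : n.+1%:R != 0 :> R by rewrite pnatr_eq0.
  move: n.+1%:R m.+1%:R => a b a0 b0.
  by field; rewrite ?a0 ?b0.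
have h'0 : 0 < h' by rewrite divr_gt0// ltr0n.
have h'h : h' <= h.
  by rewrite hh' ler_peMl ?(ltW h'0)// ler1n.
have sP := @smooth_sublinear R d e e0.
have Chp : sg^-1 * (2 * L) * (M * h `^ p) <= eps / 8.
  have hp : h `^ p <= eps / 8 / (C + 1) by apply: rP; rewrite hr ltW.
  rewrite mulrA -/C; apply: (le_trans (ler_wpM2l C0 hp)).
  have -> : C * (eps / 8 / (C + 1)) = C / (C + 1) * (eps / 8).
    by ring.
  apply: ler_piMl; first exact: ltW.
  by rewrite ler_pdivrMr; lra.
(* Three errors of [eps / 8]: quotients in the expansion, its moment term, and the quotient of the
   single step. *)
have close v x : BL B L v ->
    `|iter m.+1 (T h') (smooth e v) x - T h (smooth e v) x| <= h * (3 * eps / 8).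
  move=> vBL; have PvBL := op_BL sP vBL.
  have hI : 0 < h <= sg by rewrite h0.
  have hI' : 0 < h' <= sg by rewrite h'0 (le_trans h'h).
  have sgI : 0 < sg <= sg by rewrite sg0 lexx.
  have := iter_expansion m.+1 x h'0 sg0 L0 PvBL
    (fun y => unif h' sg v y hI' sgI vBL).
  rewrite -hh' => h1; have h2 := unif h sg v x hI sgI vBL.
  set a := iter _ _ _ _ in h1 *.
  rewrite (quotE _ _ h0); set b := quot sg _ _ in h1 h2.
  have -> : a - (smooth e v x + h * quot h (smooth e v) x) =
      (a - smooth e v x - h * b) - h * (quot h (smooth e v) x - b) by ring.
  apply: (le_trans (ler_normB _ _)).
  have h3 : `|h * (quot h (smooth e v) x - b)| <= h * (eps / 8).
    by rewrite normrM gtr0_norm// ler_pM2l.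
  have h4 : h * (eps / 8 + sg^-1 * (2 * L) * (M * h `^ p)) <= h * (eps / 8 + eps / 8).
    by rewrite ler_pM2l// lerD2l.
  have -> : h * (3 * eps / 8) = h * (eps / 8 + eps / 8) + h * (eps / 8) by field.
  by apply: lerD h3; apply: le_trans h1 h4.
have sQ := sublinear_op_iter m.+1 (sT h').
have nh : n.+1%:R * (h * (3 * eps / 8)) <= 3 * eps / 8.
  rewrite mulrA (_ : n.+1%:R * h = s); last first.
    by rewrite /h mulrCA divff ?mulr1// pnatr_eq0.
  by apply: ler_piMl; [lra|case/andP: s01].
have h1 : iter n.+1 (T h) u z <=
   iter n.+1 (iter m.+1 (T h')) u z + 2 * (nword R d * (L * e)) +
   n.+1%:R * (h * (3 * eps / 8)).
  apply: (iter_smooth_le (B := B)) => // v vBL x.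
  by have := close v x vBL; rewrite distrC ler_distl => /andP[_]; rewrite addrC.
have h2 : iter n.+1 (iter m.+1 (T h')) u z <=
   iter n.+1 (T h) u z + 2 * (nword R d * (L * e)) +
   n.+1%:R * (h * (3 * eps / 8)).
  apply: (iter_smooth_le (B := B)) => // v vBL x.
  by have := close v x vBL; rewrite ler_distl => /andP[_]; rewrite addrC.
rewrite iterM; set a := iter n.+1 (T h) u z in h1 h2 *.
set b := iter n.+1 _ u z in h1 h2 *.
by rewrite ler_norml; apply/andP; split; lra.
Qed.

(** Both step sizes are compared with their common refinement into [n.+1 * m.+1] steps. *)
Lemma iter_cauchy B L s u eps : 0 <= L -> 0 < s <= 1 -> BL B L u -> 0 < eps ->
  exists N : nat, forall n m z, (N <= n)%N -> (N <= m)%N ->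
    `|iter n.+1 (T (s / n.+1%:R)) u z - iter m.+1 (T (s / m.+1%:R)) u z| <= eps.
Proof.
move=> L0 s01 uBL eps0; have e2 : 0 < eps / 2 by rewrite divr_gt0.
have [N NP] := iter_refine B L0 s01 e2.
exists N => n m z Nn Nm.
have h1 := NP n m u z Nn uBL; have h2 := NP m n u z Nm uBL.
rewrite (mulnC m.+1) distrC in h2.
rewrite (splitr eps).
apply: le_trans (ler_distD (iter (n.+1 * m.+1) (T (s / (n.+1 * m.+1)%:R)) u z) _ _) _.
exact: lerD.
Qed.

(** [l sg] is counted twice: in comparing the quotients at scales [h] and [sg], and in replacing
    [quot sg phi] by [A]. *)
Lemma iter_generator B L phi (A : E -> R) (l : R -> R) s sg n z :
  0 <= L -> BL B L phi ->
  (forall s z, 0 < s <= 1 -> `|quot s phi z - A z| <= l s) ->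
  0 < s <= 1 -> 0 < sg <= 1 ->
  `|iter n.+1 (T (s / n.+1%:R)) phi z - phi z - s * A z| <=
    s * (l (s / n.+1%:R) + 2 * l sg + sg^-1 * (2 * L) * (M * s `^ p)).
Proof.
move=> L0 phiBL lP s01 sg01; have /andP[s0 s1] := s01; have /andP[sg0 sg1] := sg01.
set h := s / n.+1%:R; have h0 : 0 < h by rewrite divr_gt0.
have hs : n.+1%:R * h = s by rewrite /h mulrCA divff ?mulr1// pnatr_eq0.
have h01 : 0 < h <= 1.
  by rewrite h0/= (le_trans _ s1)// -hs ler_peMl ?(ltW h0)// ler1n.
have close x : `|quot h phi x - quot sg phi x| <= l h + l sg.
  apply: le_trans (ler_distD (A x) _ _) _.
  by rewrite (distrC (A x)); apply: lerD; exact: lP.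
have := iter_expansion n.+1 z h0 sg0 L0 phiBL close; rewrite hs => h1.
set a := iter _ _ _ _ in h1 *; set b := quot sg _ _ in h1.
have -> : a - phi z - s * A z = (a - phi z - s * b) + s * (b - A z) by ring.
apply: (le_trans (ler_normD _ _)).
have h2 : `|s * (b - A z)| <= s * l sg.
  by rewrite normrM gtr0_norm// ler_pM2l//; exact: lP.
have -> : s * (l h + 2 * l sg + sg^-1 * (2 * L) * (M * s `^ p)) =
  s * (l h + l sg + sg^-1 * (2 * L) * (M * s `^ p)) + s * l sg by ring.
exact: lerD.
Qed.


(** The Cauchy property gives [ell s], and [o s] is the supremum of its modulus. As [n] grows, the
    term [l (s / n.+1%:R)] disappears from [iter_generator]; then [sg] is fixed to make [l sg]
    small, and only afterwards [s] to make the moment term small. *)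
Lemma scheme_limit phi (A : E -> R) (l : R -> R) : Cb 3 phi ->
  (forall eta, 0 < eta -> exists2 s0, 0 < s0 & forall s, 0 < s <= s0 -> l s <= eta) ->
  (forall s z, 0 < s <= 1 -> `|quot s phi z - A z| <= l s) ->
  exists (ell : R -> E -> R) (o : R -> R),
    (forall eps, 0 < eps -> exists2 r, 0 < r & forall s, 0 < s <= r ->
       0 <= o s <= s * eps) /\
    forall s, 0 < s <= 1 ->
      (forall eps, 0 < eps -> exists N : nat, forall n z, (N <= n)%N ->
         `| `|iter n.+1 (T (s / n.+1%:R)) phi z - phi z - s * A z| - ell s z| <= eps) /\
      forall z, `|ell s z| <= o s.
Proof.
move=> phiC l0 lP.
have [B [L [L0 phiBL]]] := bl_nonneg (Cb3_bl phiC).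
pose X s n z := `|iter n.+1 (T (s / n.+1%:R)) phi z - phi z - s * A z|.
have /choice[ell ellP] : forall s, exists e : E -> R, 0 < s <= 1 ->
    forall eps, 0 < eps -> exists N : nat, forall n z, (N <= n)%N ->
      `|X s n z - e z| <= eps.
  move=> s; have [s01|ns] := boolP (0 < s <= 1); last by exists (fun=> 0).
  have [|e eP] := @uniform_cauchy_limit R E (X s); last by exists e.
  move=> eps eps0; have [N NP] := iter_cauchy L0 s01 phiBL eps0.
  exists N => n m z Nn Nm; apply: le_trans (NP n m z Nn Nm).
  apply: le_trans (ler_dist_dist _ _) _; rewrite le_eqVlt; apply/orP; left; apply/eqP.
  by congr `|_|; ring.
have ell_le s sg z : 0 < s <= 1 -> 0 < sg <= 1 ->
    `|ell s z| <= s * (2 * l sg + sg^-1 * (2 * L) * (M * s `^ p)).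
  move=> s01 sg01; apply/ler_addgt0Pr => eps eps0.
  have s0 : 0 < s by case/andP: s01.
  have e2 : 0 < eps / 2 by rewrite divr_gt0.
  have [N NP] := ellP s s01 _ e2.
  have [|r r0 rP] := l0 (eps / 2 / s); first by rewrite divr_gt0.
  have [N' N'P] := step_small r0.
  pose n := maxn N N'.
  have h1 := NP n z (leq_maxl _ _).
  have h2 := iter_generator n z L0 phiBL lP s01 sg01; rewrite -/(X s n z) in h2.
  have h3 : s * l (s / n.+1%:R) <= eps / 2.
    rewrite mulrC -ler_pdivlMr//; apply: rP; exact: N'P (leq_maxr _ _) s01.
  have X0 : 0 <= X s n z by exact: normr_ge0.
  rewrite -addrA mulrDr in h2; set C := s * (2 * _ + _) in h2 *.
  by move: h1; rewrite !ler_norml => /andP[? ?]; apply/andP; split; lra.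
exists ell, (fun s => sup (range (fun z => `|ell s z|))).
have ell_o s z : 0 < s <= 1 -> `|ell s z| <= sup (range (fun z => `|ell s z|)).
  move=> s01; apply: ub_le_sup; last by exists z.
  have I1 : 0 < (1 : R) <= 1 by rewrite ltr01 lexx.
  by eexists => _ [y _ <-]; exact: (ell_le s 1 y s01 I1).
split=> [eps eps0|s s01]; last by split=> [|z]; [exact: ellP|exact: ell_o].
have [|s0 s00 ls0] := l0 (eps / 4); first by rewrite divr_gt0.
pose sg := Num.min 1 s0.
have sg0 : 0 < sg by rewrite lt_min ltr01.
have sg1 : 0 < sg <= 1 by rewrite sg0 ge_min lexx.
have lsg : l sg <= eps / 4 by apply: ls0; rewrite sg0 ge_min lexx orbT.
pose C := sg^-1 * (2 * L) * M.
have C0 : 0 <= C by rewrite !mulr_ge0// invr_ge0 ltW.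
have [|r r0 rP] := @powR_small (eps / 2 / (C + 1)).
  by rewrite !divr_gt0//; lra.
exists (Num.min 1 r) => [|s /andP[s_gt0]]; first by rewrite lt_min ltr01.
rewrite le_min => /andP[s1 sr]; have s01 : 0 < s <= 1 by rewrite s_gt0.
apply/andP; split; first exact: le_trans (ell_o s 0 s01).
apply: ge_sup; first by exists `|ell s 0|, 0.
move=> _ [z _ <-]; apply: (le_trans (ell_le s sg z s01 sg1)).
rewrite ler_pM2l//.
have hp : s `^ p <= eps / 2 / (C + 1) by apply: rP; rewrite sr ltW.
have : sg^-1 * (2 * L) * (M * s `^ p) <= eps / 2.
  rewrite mulrA -/C; apply: (le_trans (ler_wpM2l C0 hp)).
  have -> : C * (eps / 2 / (C + 1)) = C / (C + 1) * (eps / 2) by ring.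
  apply: ler_piMl; first by rewrite divr_ge0// ltW.
  by rewrite ler_pdivrMr; lra.
lra.
Qed.

End scheme.

(** * Application to the i.i.d. sequence *)

Lemma L0_dim_gt0 (R : realType) (d : nat) (alpha lo hi : R) nu : 0 < lo ->
  @L0 R d alpha lo hi nu -> (0 < d)%N.
Proof.
move=> lo0 [mu [_ /andP[+ _]] _]; case: d nu mu => // nu mu.
(* In dimension 0 every vector has norm 0, so the sphere is empty and carries no mass. *)
rewrite (_ : sphere R 0 = set0) ?measure0; last first.
  apply/seteqP; split=> // z; rewrite /sphere/= /enorm /dot big_ord0 sqrtr0.
  by move/eqP; rewrite eq_sym oner_eq0.
by rewrite lte_fin ltNge (ltW lo0).
Qed.

Lemma cvg_at_right0P (R : realType) (l : R -> R) : l s @[s --> 0^'+] --> 0 ->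
  forall eta, 0 < eta -> exists2 s0, 0 < s0 & forall s, 0 < s <= s0 -> `|l s| <= eta.
Proof.
move=> /cvgrPdist_le lP eta eta0; have [r /= r0 rP] := lP eta eta0.
exists (r / 2); first by rewrite divr_gt0.
move=> s /andP[s0 sr]; have := rP s; rewrite /ball_/= !sub0r !normrN.
by apply => //; rewrite gtr0_norm//; lra.
Qed.

Theorem theorem4p5 (R : realType) (d : nat) (alpha lo hi : R)
  (halpha : 1 < alpha < 2) (hlo : 0 < lo) (hlohi : lo < hi)
  (L : set {measure set (borel R d) -> \bar R})
  (L_sub : L `<=` L0 alpha lo hi) (L_neq0 : L !=set0)
  (L_compact : compact_levy alpha L) (L_convex : convex_measures L)
  (Omega : Type) (S : sublinear_space R Omega)
  (Z : nat -> Omega -> 'rV[R]_d)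
  (Z_rv : forall i, random_var S (Z i)) (Z_iid : iid S Z)
  (Z_dom : forall j : 'I_d, dom S (fun w => Z 0%N w 0 j))
  (S_dom : forall n, dom S (fun w => enorm (psum Z n w)))
  (A2_mean : Evec S (Z 0%N) = 0)
  (A2_meanN : Evec S (fun w => - Z 0%N w) = 0)
  (A2_bound : has_ubound
     [set Ehat S (fun w => n%:R `^ (- alpha^-1) * enorm (psum Z n w))
        | n in [set n : nat | (0 < n)%N]])
  (A3 : forall phi : 'rV[R]_d -> R, Cb 3 phi ->
     exists2 l : R -> R, l s @[s --> 0^'+] --> 0 &
       forall (z : 'rV[R]_d) (s : R), 0 < s <= 1 ->
         s^-1 * `|Ehat S (fun w => phi (z + s `^ alpha^-1 *: Z 0%N w) - phi z)
                  - s * levy_sup L phi z| <= l s) :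
  forall phi : 'rV[R]_d -> R, Cb 3 phi ->
    exists (ell : R -> 'rV[R]_d -> R) (o : R -> R),
      (o s / s) @[s --> 0^'+] --> 0 /\
      forall s : R, 0 <= s <= 1 ->
        {uniform, (fun (n : nat) (z : 'rV[R]_d) =>
           `|Ehat S (fun w => phi (z + (s / n%:R) `^ alpha^-1 *: psum Z n w)
                              - phi z)
             - s * levy_sup L phi z|) @ \oo --> ell s} /\
        forall z : 'rV[R]_d, `|ell s z| <= o s.
Proof.
move=> phi phiC.
(* Gluing needs a coordinate direction along which to place the centres. *)
have [nu Lnu] := L_neq0; have d0 := L0_dim_gt0 hlo (L_sub _ Lnu).
have alpha1 : 1 < alpha by case/andP: halpha.
have alpha0 : 0 < alpha by lra.
pose p := alpha^-1; have p0 : 0 < p by rewrite invr_gt0.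
have p_neq0 : p != 0 by rewrite gt_eqF.
have [M0 M0P] := A2_bound; pose M := `|M0|.
pose T h := shift_op S Z (h `^ p).
have sT h : sublinear_op (T h) by exact: shift_op_sublinear.
have T_scale h r u : 0 < h -> 0 < r -> bl u ->
    T h (fun x => u (r^-1 *: x)) 0 = T (h * r `^ (- alpha)) u 0.
  move=> h0 r0 _; congr Ehat; apply/funext => w.
  rewrite !add0r scalerA powRM ?powR_ge0 ?(ltW h0)//.
  by rewrite -powRrM mulNr divff ?gt_eqF// powR_inv1 ?ltW// mulrC.
have T_moment B L' h n u z : 0 < h -> 0 <= L' -> BL B L' u ->
    `|iter n (T h) u z - u z| <= L' * (M * (n%:R * h) `^ p).
  (* [A2_bound] concerns positive [n] only; zero steps change nothing. *)
  move=> h0 L'0 uBL; case: n => [|n].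
    rewrite subrr normr0; exact: (mulr_ge0 L'0 (mulr_ge0 (normr_ge0 _) (powR_ge0 _ _))).
  apply: le_trans (iter_shift_close Z_rv Z_iid S_dom z n.+1 (powR_ge0 _ _) L'0 uBL) _.
  apply: ler_wpM2l => //; rewrite powRM ?(ltW h0)//.
  set X := Ehat S _; have n0 : 0 < (n.+1%:R : R) by rewrite ltr0n.
  have : n.+1%:R `^ (- p) * X <= M0.
    by rewrite /X -Ehat_scale ?powR_gt0//; apply: M0P; exists n.+1.
  move=> /le_trans/(_ (ler_norm M0)); rewrite powRN mulrC ler_pdivrMr ?powR_gt0// => XM.
  by rewrite mulrC mulrA; apply: ler_wpM2r => //; exact: powR_ge0.
have Ehat_subc f c z n : bl f ->
    Ehat S (fun w => f (z + c *: psum Z n w) - f z) =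
    iter n (shift_op S Z c) f z - f z.
  move=> blf; have sc := shift_op_sublinear Z_rv c.
  have := Ehat_psum Z_rv Z_iid c z n (bl_add blf (bl_cst (- f z))) => ->.
  exact: (op_addc (sublinear_op_iter n sc) (- f z) blf z).
have consistent f : Cb 3 f -> exists l : R -> R,
    (forall eta, 0 < eta -> exists2 s0, 0 < s0 & forall s, 0 < s <= s0 -> l s <= eta) /\
    forall s z, 0 < s <= 1 -> `|quot T s f z - levy_sup L f z| <= l s.
  move=> fC; have [l /cvg_at_right0P l0 lP] := A3 f fC; exists l; split.
    move=> eta eta0; have [s0 s00 s0P] := l0 eta eta0; exists s0 => // s ss0.
    exact: le_trans (ler_norm _) (s0P s ss0).
  move=> s z s01; have s0 : 0 < s by case/andP: s01.
  have := lP z s s01.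
  have -> : Ehat S (fun w => f (z + s `^ alpha^-1 *: Z 0%N w) - f z) = T s f z - f z.
    rewrite -(Ehat_subc f (s `^ p) z 1%N (Cb3_bl fC)).
    by congr Ehat; apply/funext => w; rewrite /psum big_ord1.
  apply: le_trans; rewrite -[X in X * _]gtr0_norm ?invr_gt0// -normrM mulrBr.
  by rewrite mulrA mulVf ?gt_eqF// mul1r.
have [l [l0 lP]] := consistent phi phiC.
have [|ell [om [om0 ellP]]] := scheme_limit alpha1 p0 (normr_ge0 M0) sT T_scale
    T_moment _ d0 phiC l0 lP.
  by move=> f /consistent[l' l'P]; exists (levy_sup L f), l'.
(* At [s = 0] the error vanishes for every [n], so both witnesses are 0 there. *)
exists (fun s z => if s == 0 then 0 else ell s z), (fun s => if s == 0 then 0 else om s).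
split.
  apply/cvgrPdist_le => eps eps0; have [r r0 rP] := om0 eps eps0.
  exists r => //= s; rewrite /ball_/= sub0r normrN => sr s0.
  rewrite (gtr0_norm s0) in sr; have /andP[os os'] : 0 <= om s <= s * eps.
    by apply: rP; rewrite s0 ltW.
  by rewrite gt_eqF// sub0r normrN ger0_norm ?divr_ge0 ?(ltW s0)// ler_pdivrMr// mulrC.
move=> s s01; have [->|s_neq0] := eqVneq s 0.
  split=> [P /uniform_nbhs[D [Dent DP]]|z]; last by rewrite normr0.
  exists 0%N => // n _; apply: DP => z _ /=.
  rewrite !mul0r powR0// subr0 (_ : (fun w => _) = (fun=> 0)).
    by rewrite Ehat_cst normr0; exact: entourage_refl.
  by apply/funext => w; rewrite scale0r addr0 subrr.
have s_gt0 : 0 < s <= 1 by rewrite lt0r s_neq0.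
have [ell_lim ell_o] := ellP s s_gt0; split=> [P /uniform_nbhs[D [Dent DP]]|]; last first.
  exact: ell_o.
have [eps /= eps0 epsD] : exists2 eps : R, 0 < eps &
    forall x y : R, `|x - y| < eps -> D (x, y).
  by move: Dent; rewrite -entourage_ballE => -[eps /= eps0 eD]; exists eps => // x y xy; exact: eD.
have e2 : 0 < eps / 2 by rewrite divr_gt0.
(* Starting at [N.+1] skips the index 0, where [s / n%:R] divides by zero, and matches the [n.+1]
   steps of the scheme. *)
have [N NP] := ell_lim _ e2; exists N.+1 => // -[//|n] /= Nn.
apply: DP => z _; apply: epsD.
rewrite (Ehat_subc phi _ z n.+1 (Cb3_bl phiC)) distrC (le_lt_trans (NP n z Nn))//; lra.
Qed.
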